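(* For $\lambda\in\mathbb Z_+$ and $n\ge0$ with $\lambda\equiv n \pmod 2$, let $$m(\lambda,n)=\binom{n}{\frac{n+\lambda}{2}}-\binom{n}{\frac{n+\lambda+2}{2}}=\frac{\lambda+1}{\frac{n+\lambda+2}{2}}\binom{n}{\frac{n+\lambda}{2}}$$ be the number of non-negative $\pm1$-step paths of length $n$ from $0$ to $\lambda$. Then, as $n\to\infty$ (with $n\equiv\lambda\pmod 2$), $$m(\lambda,n)\sim 2\sqrt2\,\frac{2^n}{\sqrt\pi}\,\frac{1}{n^{3/2}}\sum_{j\ge0}\frac{(-1)^j}{n^j}h_j(\lambda),$$ where for $j\ge0$ $$h_j(\lambda)=\sum_{p=0}^{j}\sum_{k=0}^{p}\frac{(-1)^k}{(2(j-p)+1)!}\,C^\alpha_{k,p}\,m_{2(k+j+1)}\,(\lambda+1)^{2(j-p)+1},$$ with $m_{2k}=\frac{(2k)!}{2^kk!}$ the $2k$-th Gaussian moment.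
   Context: Define $\alpha(m)=\frac{(4^m-1)|B_{2m}|2^{2m}}{2m\,(2m)!}$ for $m\ge1$, where $B_{2m}$ are the Bernoulli numbers. The partial ordinary Bell polynomials $B_{n,k}(x_1,\dots,x_{n-k+1})$ are defined by the formal expansion $\exp\big(u\sum_{m\ge1}x_mt^m\big)=\sum_{n\ge k\ge0}B_{n,k}(x_1,\dots,x_{n-k+1})\,t^n\frac{u^k}{k!}$. Set $B^\alpha_{s,k}=B_{s,k}(\alpha(2),\dots,\alpha(s-k+2))$ for $s\ge k\ge0$, and $C^\alpha_{k,p}=\frac{1}{k!}\sum_{j=k}^{p}\frac{(-1)^j}{(2p-2j+1)!}B^\alpha_{j,k}$ for $p\ge k\ge0$. The symbol $\sim$ denotes a (Poincaré) asymptotic expansion in powers of $1/n$. *)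

(* Defs.v *)
From HB Require Import structures.
From mathcomp Require Import all_boot all_order all_algebra.
From mathcomp Require Import all_classical all_reals all_analysis.

Set Implicit Arguments.
Unset Strict Implicit.
Unset Printing Implicit Defensive.

Import Order.TTheory GRing.Theory Num.Theory.
Import numFieldNormedType.Exports.

Local Open Scope classical_set_scope.
Local Open Scope ring_scope.

Section Bernoulli.
Variable R : realType.

(* [:: B_0; ...; B_(n-1)], each entry obtained by solving
   \sum_(k <= i) 'C(i + 1, k) B_k = [i = 0] for B_i. *)
Fixpoint bernoulli_seq (n : nat) : seq R :=
  if n is i.+1 then
    let s := bernoulli_seq i in
    rcons s (((i == 0)%:R - \sum_(k < i) 'C(i.+1, k)%:R * s`_k) / i.+1%:R)
  else [::].

Definition bernoulli_num (n : nat) : R := (bernoulli_seq n.+1)`_n.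

Lemma size_bernoulli_seq n : size (bernoulli_seq n) = n.
Proof. by elim: n => //= n IHn; rewrite size_rcons IHn. Qed.

Lemma nth_bernoulli_seq n k : (k < n)%N ->
  (bernoulli_seq n)`_k = bernoulli_num k.
Proof.
elim: n => // n IHn; rewrite ltnS leq_eqVlt => /predU1P[->//|ltkn].
by rewrite /= nth_rcons size_bernoulli_seq ltkn IHn.
Qed.

Lemma bernoulli_num_rec n :
  \sum_(k < n.+1) 'C(n.+1, k)%:R * bernoulli_num k = (n == 0)%:R.
Proof.
rewrite big_ord_recr /= {2}/bernoulli_num /= nth_rcons size_bernoulli_seq.
rewrite ltnn eqxx binSn mulrC divfK ?pnatr_eq0 //.
under [X in _ - X]eq_bigr => k _ do rewrite nth_bernoulli_seq ?ltn_ord //.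
by rewrite addrC subrK.
Qed.

End Bernoulli.

Section Bell.
Variable R : realType.
Implicit Types x : nat -> R.

(* \sum_(1 <= m <= N) x_m t^m *)
Definition gen_trunc x (N : nat) : {poly R} :=
  \sum_(1 <= m < N.+1) x m *: 'X^m.

(* exp(u * \sum_(m >= 1) x_m t^m), with the inner sum and the exponential
   series both cut after the N-th term; the outer variable of {poly {poly R}}
   is u and the inner one is t. *)
Definition exp_gen_trunc x (N : nat) : {poly {poly R}} :=
  \sum_(i < N.+1) ((i`!)%:R^-1 : R)%:P *: ('X * (gen_trunc x N)%:P) ^+ i.

(* k! times the coefficient of t^n u^k in the formal series; the cut at n + k
   does not affect this coefficient, see bell_expansion below. *)
Definition bell (n k : nat) x : R :=
  (k`!)%:R * (exp_gen_trunc x (n + k))`_k`_n.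

Lemma coef_exp_gen_trunc x N n k : (k <= N)%N ->
  (exp_gen_trunc x N)`_k`_n = (k`!)%:R^-1 * (gen_trunc x N ^+ k)`_n.
Proof.
move=> lekN; rewrite /exp_gen_trunc coef_sum.
rewrite (bigD1 (Ordinal (lekN : k < N.+1)%N)) //= big1 => [|i ik].
  rewrite addr0 coefZ exprMn_comm ?coefXnM; last exact/commr_sym/commr_polyX.
  by rewrite ltnn subnn -polyC_exp coefC eqxx coefCM.
rewrite coefZ exprMn_comm ?coefXnM; last exact/commr_sym/commr_polyX.
rewrite -polyC_exp coefC subn_eq0; case: ltnP; rewrite ?mulr0 // => leik.
case: leqP; rewrite ?mulr0 // => leki; case/eqP: ik; apply/val_inj => /=.
by apply/eqP; rewrite eqn_leq leik leki.
Qed.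

Lemma coef_gen_truncX x N M n k : (n <= N)%N -> (N <= M)%N ->
  (gen_trunc x M ^+ k)`_n = (gen_trunc x N ^+ k)`_n.
Proof.
move=> lenN leNM.
have eqc i : (i <= N)%N -> (gen_trunc x M)`_i = (gen_trunc x N)`_i.
  move=> leiN; rewrite /gen_trunc (big_cat_nat (n := N.+1)) //= coefD.
  rewrite [X in _ + X]coef_sum [X in _ + X]big_nat [X in _ + X]big1 ?addr0//.
  move=> j /andP[ltNj _]; rewrite coefZ coefXn.
  by rewrite ltn_eqF ?mulr0 // (leq_ltn_trans leiN).
elim: k n lenN => [|k IHk] n lenN; first by rewrite !expr0.
rewrite !exprS !coefM; apply: eq_bigr => i _.
rewrite eqc ?IHk //; first exact: leq_trans (leq_subr _ _) lenN.
exact: leq_trans (leq_ord i) lenN.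
Qed.

Lemma bell_expansion x N n k : (n <= N)%N -> (k <= N)%N ->
  (exp_gen_trunc x N)`_k`_n = bell n k x / (k`!)%:R.
Proof.
move=> lenN lekN; rewrite /bell mulrC mulKf ?pnatr_eq0 -?lt0n ?fact_gt0 //.
rewrite !coef_exp_gen_trunc ?leq_addl //; congr (_ * _).
have le1 : (n <= maxn N (n + k))%N by rewrite leq_max lenN.
by rewrite -(@coef_gen_truncX _ N (maxn N (n + k))) ?leq_maxl //
  (@coef_gen_truncX _ (n + k) (maxn N (n + k))) ?leq_maxr ?leq_addr.
Qed.

End Bell.

Section Coefficients.
Variable R : realType.

Definition alpha (m : nat) : R :=
  (4 ^+ m - 1) * `|bernoulli_num R (2 * m)| * 2 ^+ (2 * m)
  / ((2 * m)%:R * ((2 * m)`!)%:R).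

Definition bell_alpha (s k : nat) : R := bell s k (fun m => alpha m.+1).

Definition C_alpha (k p : nat) : R :=
  (k`!)%:R^-1 * \sum_(k <= j < p.+1)
     (-1) ^+ j / ((2 * p - 2 * j + 1)`!)%:R * bell_alpha j k.

(* the moment of even order 2 * k *)
Definition gauss_moment (k : nat) : R :=
  ((2 * k)`!)%:R / (2 ^+ k * (k`!)%:R).

Definition h_coef (j lambda : nat) : R :=
  \sum_(0 <= p < j.+1) \sum_(0 <= k < p.+1)
     (-1) ^+ k / ((2 * (j - p) + 1)`!)%:R * C_alpha k p
     * gauss_moment (k + j + 1) * lambda.+1%:R ^+ (2 * (j - p) + 1).

(* Meaningful only for n = lambda %[mod 2], where the halves are exact. *)
Definition mult (lambda n : nat) : R :=
  'C(n, (n + lambda)./2)%:R - 'C(n, (n + lambda + 2)./2)%:R.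

End Coefficients.

(* A path is given by its steps: true is +1 and false is -1. *)
Definition height (s : seq bool) : int := \sum_(b <- s) (if b then 1 else -1).

Definition nonneg_paths (lambda n : nat) : {set n.-tuple bool} :=
  [set s : n.-tuple bool |
    [forall i : 'I_n.+1, 0 <= height (take i s)] && (height s == lambda%:Z)].

(* f(n) ~ g(n) * \sum_(j >= 0) a_j / n^j along F, in the sense of Poincare *)
Definition asymptotic_expansion (R : realType) (F : filter_on nat)
    (f g a : nat -> R) : Prop :=
  forall N : nat,
    (fun n => f n - g n * \sum_(j < N.+1) a j / n%:R ^+ j)
      =o_F (fun n => g n / n%:R ^+ N).

(* Main.v *)
(* The multiplicity is a Fourier integral: with mu = lambda + 1,
   m(lambda, n) = 2^(n+2)/pi * \int_0^(pi/2) cos^n x sin x sin(mu x) dx,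
   since both sides satisfy the last-step recurrence of the path count.  Laplace's
   method then gives the expansion: cos^n x = e^(-n x^2/2) e^(-n rho(x)) with
   rho = - ln cos - x^2/2 >= 0, where e^(-n rho) is replaced by its Taylor
   polynomial in n rho and rho^k sin x sin(mu x) by its Taylor polynomial at 0; up to
   rapidly decaying errors, integrating x^(2i) against e^(-n x^2/2) yields the
   Gaussian moments.

   The Taylor coefficients of rho are the alpha(m).  Those of tan are nonnegative, by
   tan' = 1 + tan^2, and the generating function of the Bernoulli numbers determines
   them up to the sign of B_(2m), so this positivity is what produces |B_(2m)|. *)
Require Import Defs.
From HB Require Import structures.
From mathcomp Require Import all_boot all_order all_algebra.
From mathcomp Require Import all_classical all_reals all_analysis.
From mathcomp Require Import ring lra zify.

Set Implicit Arguments.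
Unset Strict Implicit.
Unset Printing Implicit Defensive.

Import Order.TTheory GRing.Theory Num.Theory.
Import numFieldNormedType.Exports.

Local Open Scope classical_set_scope.
Local Open Scope ring_scope.

(** * Path counting *)

(** Since - ln cos x is unbounded near pi/2, [rho] is used on [0, 1] only. On [1, pi/2] all powers
    of x are at least 1, so cos x <= e^(-x^2/2) and crude bounds suffice there. A single error bound
    C e^(-n x^2/2) sum_k n^k x^(2(k+N+2)) therefore holds on all of [0, pi/2]. Under the Gaussian
    weight each x^2 is worth 1/n, so every term of this bound integrates to order n^(-N-5/2), one
    order beyond the last term n^(-N-3/2) that is kept. Because rho = O(x^4), N+2 Taylor terms in n
    rho are enough for this. Infinite series are avoided. Formal identities are congruences of
    polynomials modulo X^N, analytic ones are Taylor remainders on [0, 1], and uniqueness of Taylor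
    polynomials links the two: it identifies the formal quotient given by the Bernoulli numbers with
    the iterates that solve tan' = 1 + tan^2, whose coefficients are visibly nonnegative. *)

(** The last-step recurrence, with a barrier below 0. It is the common value through which the
    paths, the binomial formula and the Fourier integral are compared. *)
Fixpoint walk_count (lambda n : nat) : nat :=
  if n is n'.+1 then
    (walk_count lambda.+1 n' + if lambda is l.+1 then walk_count l n' else 0)%N
  else (lambda == 0)%N.

Definition nonneg_prefixes (s : seq bool) : bool :=
  all (fun i => 0 <= height (take i s)) (iota 0 (size s).+1).

Lemma mem_nonneg_paths lambda n (s : n.-tuple bool) :
  (s \in nonneg_paths lambda n) = nonneg_prefixes s && (height s == lambda%:Z).
Proof.
rewrite inE; congr (_ && _); apply/forallP/allP => [h i|h i].
  by rewrite size_tuple mem_iota => /andP[_ lt]; exact: (h (Ordinal lt)).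
by apply: h; rewrite size_tuple mem_iota /= add0n.
Qed.

Lemma height_rcons s b : height (rcons s b) = height s + (if b then 1 else -1).
Proof. by rewrite /height -cats1 big_cat big_seq1. Qed.

Lemma nonneg_prefixes_rcons s b : nonneg_prefixes (rcons s b) =
  nonneg_prefixes s && (0 <= height (rcons s b)).
Proof.
rewrite /nonneg_prefixes size_rcons -[(size s).+2]addn1 iotaD all_cat all_seq1.
rewrite add0n take_oversize ?size_rcons //; congr (_ && _).
apply: eq_in_all => i; rewrite mem_iota /= add0n ltnS => le.
by rewrite -cats1 takel_cat.
Qed.

Lemma nonneg_prefixes_height s : nonneg_prefixes s -> 0 <= height s.
Proof.
move=> /allP /(_ (size s)); rewrite take_size; apply.
by rewrite mem_iota add0n /=.
Qed.

Lemma card_nonneg_paths lambda n : #|nonneg_paths lambda n| = walk_count lambda n.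
Proof.
elim: n lambda => [|n IHn] lambda.
  rewrite -sum1_card /= (eq_bigl (fun=> lambda == 0%N)) => [|s]; last first.
    rewrite mem_nonneg_paths tuple0 /nonneg_prefixes /= /height big_nil lexx.
    by rewrite eq_sym.
  case: eqP => _; last by rewrite big_pred0.
  by rewrite sum1_card card_tuple expn0.
(* A path is its first n steps followed by its last step; [A b] below collects the prefixes that the
   last step b completes. *)
pose f (p : n.-tuple bool * bool) : n.+1.-tuple bool := [tuple of rcons p.1 p.2].
have bij_f : bijective f.
  apply: inj_card_bij => [[s b] [t c] /(congr1 val)/= /rcons_inj[/val_inj -> ->] //|].
  by rewrite card_prod !card_tuple card_bool expnSr.
rewrite -sum1_card (reindex f) /=; last exact: onW_bij.
pose A b := [pred s : n.-tuple bool | f (s, b) \in nonneg_paths lambda n.+1].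
have -> : (\sum_(p | f p \in nonneg_paths lambda n.+1) 1 = #|A true| + #|A false|)%N.
  rewrite -!sum1_card [RHS]addnC big_mkcond (eq_bigr (fun p : n.-tuple bool * bool =>
    if p.2 then if f (p.1, true) \in nonneg_paths lambda n.+1 then 1 else 0
    else if f (p.1, false) \in nonneg_paths lambda n.+1 then 1 else 0)%N); last first.
    by case=> s [].
  rewrite -(pair_bigA _ (fun s b => if b
    then if f (s, true) \in nonneg_paths lambda n.+1 then 1 else 0
    else if f (s, false) \in nonneg_paths lambda n.+1 then 1 else 0))%N.
  rewrite exchange_big big_bool /= addnC.
  by rewrite !(big_mkcond (fun s => s \in A _)).
rewrite addnC -!IHn; congr addn.
  apply: eq_card => s; rewrite inE !mem_nonneg_paths /= nonneg_prefixes_rcons.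
  rewrite height_rcons subr_eq -PoszD addn1 -andbA; congr (_ && _).
  by case: eqP => [->|]; rewrite ?andbF // andbT; lia.
case: lambda @A => [|lambda] A; last first.
  rewrite -IHn; apply: eq_card => s; rewrite inE !mem_nonneg_paths /=.
  rewrite nonneg_prefixes_rcons height_rcons -andbA; congr (_ && _).
  by apply/andP/eqP => [[_ /eqP]|->]; [|split]; lia.
(* If the last step goes up to 0, the prefix would end at height -1. *)
apply: eq_card0 => s; rewrite inE mem_nonneg_paths /= nonneg_prefixes_rcons.
rewrite height_rcons; apply/negP => /andP[/andP[/nonneg_prefixes_height h _] /eqP].
lia.
Qed.

Lemma modn2_half (lambda n : nat) : n = lambda %[mod 2] ->
  exists k, (n + lambda = k.*2)%N.
Proof. by move=> h; exists ((n + lambda)./2); lia. Qed.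

Lemma mult_walk_count (R : realType) lambda n : n = lambda %[mod 2] ->
  mult R lambda n = (walk_count lambda n)%:R.
Proof.
elim: n lambda => [|n IHn] lambda nl; have [k kE] := modn2_half nl.
  rewrite /mult addn2 kE /= doubleK; case: lambda nl kE => [|l] nl kE.
    by case: k kE => //= _; rewrite bin0 subr0.
  by case: k kE => //= k _; rewrite !bin0n subrr.
have kgt0 : (0 < k)%N by lia.
rewrite /= natrD -IHn; last by lia.
have -> : mult R lambda n.+1 = 'C(n.+1, k)%:R - 'C(n.+1, k.+1)%:R.
  by rewrite /mult addn2 kE /= doubleK.
have -> : mult R lambda.+1 n = 'C(n, k)%:R - 'C(n, k.+1)%:R.
  by rewrite /mult addn2 addnS -addSn kE /= doubleK.
case: k kgt0 kE => // k _ kE; rewrite !binS !natrD.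
case: lambda nl kE => [|l] nl kE.
  (* For lambda = 0 the length is n = 2k+1, and the symmetry of its two middle binomials accounts
     for the missing step from below. *)
  rewrite addr0 -(@bin_sub n k); last by lia.
  by have -> : (n - k = k.+1)%N by [lia]; ring.
rewrite -IHn; last by lia.
rewrite /mult addn2; have -> : (n + l = k.*2)%N by lia.
by rewrite /= doubleK; ring.
Qed.

(** With n + lambda = 2k, multiplication by k+1 turns the second binomial into (n-k) times the
    first, and (k+1) - (n-k) = lambda + 1. *)
Lemma mult_ballot (R : realType) lambda n : n = lambda %[mod 2] ->
  mult R lambda n =
    lambda.+1%:R / ((n + lambda + 2)%:R / 2) * 'C(n, (n + lambda)./2)%:R.
Proof.
move=> /modn2_half[k kE]; rewrite /mult addn2 kE /= doubleK.
have -> : k.*2.+2%:R / 2 = k.+1%:R :> R.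
  by rewrite -doubleS -muln2 natrM mulfK ?pnatr_eq0.
have k1 : k.+1%:R != 0 :> R by rewrite pnatr_eq0.
apply: (mulfI k1); rewrite mulrBr -!natrM mul_bin_left mulrA mulrCA divff //.
rewrite mulr1 !natrM -mulrBl; have [lekn|ltnk] := leqP k n; last first.
  by rewrite bin_small // !mulr0.
congr (_ * _); rewrite natrB //.
have : (n + lambda)%:R = k.*2%:R :> R by rewrite kE.
by rewrite natrD -muln2 natrM !mulrS; lra.
Qed.

(** * The Bernoulli numbers and the formal tangent *)

Definition eqmodX (R : nzRingType) (N : nat) (p q : {poly R}) : Prop :=
  forall i, (i < N)%N -> p`_i = q`_i.

Lemma eqmodXP (R : nzRingType) N (p q : {poly R}) :
  eqmodX N p q <-> exists r, p = q + r * 'X^N.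
Proof.
split=> [pq|[r ->] i ltiN]; last by rewrite coefD coefMXn ltiN addr0.
exists (drop_poly N (p - q)); apply/polyP => i; rewrite coefD coefMXn.
case: ltnP => [/pq ->|leNi]; first by rewrite addr0.
by rewrite coef_drop_poly subnK // coefB addrC subrK.
Qed.

Lemma eqmodX_sym (R : nzRingType) N (p q : {poly R}) :
  eqmodX N p q -> eqmodX N q p.
Proof. by move=> pq i /pq. Qed.

Lemma eqmodX_trans (R : nzRingType) N (p q r : {poly R}) :
  eqmodX N p q -> eqmodX N q r -> eqmodX N p r.
Proof. by move=> pq qr i iN; rewrite pq ?qr. Qed.

(** A nonzero constant term makes p coprime to ['X^N], so it cancels by the lemma of Gauss. *)
Lemma eqmodX_mul2l (F : fieldType) N (p a b : {poly F}) :
  p`_0 != 0 -> eqmodX N (p * a) (p * b) -> eqmodX N a b.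
Proof.
move=> p0 /eqmodXP[r E]; apply/eqmodXP.
have co : coprimep 'X^N p.
  by apply: coprimep_expl; rewrite coprimep_sym coprimepX rootE horner_coef0.
have : 'X^N %| p * (a - b) by rewrite mulrBr E addrC addKr dvdp_mull.
rewrite Gauss_dvdpr // => /dvdpP[s /eqP]; rewrite subr_eq addrC => /eqP ->.
by exists s.
Qed.

Definition exp_poly (R : realType) (N : nat) (a : R) : {poly R} :=
  \poly_(i < N) (a ^+ i / (i`!)%:R).

(* The Taylor polynomials of [cos (mu * x)] and [sin (mu * x)] are [cos_poly N mu]
   and [x * sin_poly N mu] evaluated at [x ^+ 2]. *)
Definition cos_poly (R : realType) (N : nat) (mu : R) : {poly R} :=
  \poly_(i < N) ((-1) ^+ i * mu ^+ (2 * i) / ((2 * i)`!)%:R).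

Definition sin_poly (R : realType) (N : nat) (mu : R) : {poly R} :=
  \poly_(i < N) ((-1) ^+ i * mu ^+ (2 * i + 1) / ((2 * i + 1)`!)%:R).

Lemma bin_ffactV (R : realType) n i : (i <= n)%N ->
  ((i`!)%:R)^-1 * (((n - i)`!)%:R)^-1 = 'C(n, i)%:R / (n`!)%:R :> R.
Proof.
move=> lein; rewrite -(bin_fact lein) !natrM !invfM mulVKf //.
by rewrite pnatr_eq0 -lt0n bin_gt0.
Qed.

Lemma exp_polyM (R : realType) N (a b : R) :
  eqmodX N (exp_poly N a * exp_poly N b) (exp_poly N (a + b)).
Proof.
move=> n ltnN; rewrite coefM coef_poly ltnN addrC exprDn mulr_suml.
apply: eq_bigr => -[i /= lti] _; rewrite !coef_poly.
rewrite (leq_ltn_trans _ ltnN) // (leq_ltn_trans _ ltnN) ?leq_subr //.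
by rewrite mulrACA bin_ffactV // -mulr_natl; ring.
Qed.

Definition bernoulli_poly (R : realType) (N : nat) (c : R) : {poly R} :=
  \poly_(i < N) (c ^+ i * bernoulli_num R i / (i`!)%:R).

(** Read as a Cauchy product, this is the defining recurrence of the Bernoulli numbers; the
    subtracted 1 removes the top term, in accordance with the range of the sum in
    [bernoulli_num_rec]. *)
Lemma bernoulli_polyM (R : realType) N (c : R) :
  eqmodX N (bernoulli_poly N c * (exp_poly N c - 1)) (c *: 'X).
Proof.
move=> n ltnN; rewrite coefM coefZ coefX big_ord_recr /= subnn coefB coef1.
rewrite [(exp_poly _ _)`_0]coef_poly (leq_ltn_trans _ ltnN) // expr0 divr1 subrr mulr0 addr0.
case: n ltnN => [|n] ltnN; first by rewrite big_ord0 mulr0.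
transitivity (c ^+ n.+1 / (n.+1`!)%:R *
    \sum_(k < n.+1) 'C(n.+1, k)%:R * bernoulli_num R k); last first.
  rewrite bernoulli_num_rec eqSS; case: n {ltnN} => [|n]; last by rewrite !mulr0.
  by rewrite /= divr1.
rewrite mulr_sumr; apply: eq_bigr => -[i /= lti] _.
rewrite coefB coef1 !coef_poly (_ : (n.+1 - i == 0)%N = false); last by lia.
rewrite subr0 (ltn_trans lti) // (leq_ltn_trans _ ltnN) ?leq_subr //.
transitivity (c ^+ i * c ^+ (n.+1 - i) * bernoulli_num R i *
    ((i`!)%:R^-1 * ((n.+1 - i)`!)%:R^-1)); first by ring.
by rewrite bin_ffactV ?(ltnW lti) // -exprD subnKC ?(ltnW lti) //; ring.
Qed.

(* The coefficient of [x ^ (2 m)] in [x * tan x], see [tan_coefP]. *)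
Definition tan_coef (R : realType) (m : nat) : R :=
  (-1) ^+ m.+1 * (16 ^+ m - 4 ^+ m) * bernoulli_num R (2 * m) / ((2 * m)`!)%:R.

(* With u = e^x, the generating function b(x) = x / (e^x - 1) satisfies
   b(4x) - b(2x) + x = x (u - 1/u) / (u + 1/u). *)
Lemma bernoulli_tanh (R : realType) N :
  let h := bernoulli_poly N.+1 4 - bernoulli_poly N.+1 2 + 'X in
  eqmodX N (h * (exp_poly N.+1 1 + exp_poly N.+1 (-1)))
           ('X * (exp_poly N.+1 1 - exp_poly N.+1 (-1)) : {poly R}).
Proof.
case: N => [|N] /=; first by [].
set h : {poly R} := _ + 'X; set u := exp_poly _ 1; set v := exp_poly _ (-1).
have /eqmodXP[r2 E2] : eqmodX N.+2 (u * u) (exp_poly N.+2 (2 : R)).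
  by rewrite (_ : 2 = 1 + 1 :> R); [exact: exp_polyM|ring].
have /eqmodXP[r4 E4] : eqmodX N.+2 (exp_poly N.+2 2 * exp_poly N.+2 2)
    (exp_poly N.+2 (4 : R)).
  by rewrite (_ : 4 = 2 + 2 :> R); [exact: exp_polyM|ring].
have /eqmodXP[r0 E0] : eqmodX N.+2 (u * v) 1.
  move=> i lti; rewrite exp_polyM // subrr coef_poly lti coef1.
  by case: i {lti} => [|i]; rewrite ?divr1 // expr0n mul0r.
have /eqmodXP[s2 B2] := @bernoulli_polyM R N.+2 2.
have /eqmodXP[s4 B4] := @bernoulli_polyM R N.+2 4.
pose Y : {poly R} := 'X^(N.+1); have YX : 'X^(N.+2) = 'X * Y by rewrite /Y exprS.
rewrite YX in E2 E4 E0 B2 B4.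
(* The factor e^(2x) - 1, by which the identity has to be divided, has no constant term. Its ['X] is
   cancelled exactly at the cost of one order, and the cofactor [w] is invertible modulo powers of
   ['X]. *)
have [w Ew] : exists w, exp_poly N.+2 2 - 1 = 'X * w :> {poly R}.
  exists (drop_poly 1 (exp_poly N.+2 2 - 1)); apply/polyP => -[|i].
    by rewrite coefXM coefB coef_poly coef1 divr1 expr0 subrr.
  by rewrite coefXM /= coef_drop_poly addn1.
have w0 : w`_0 != 0.
  have /(congr1 (fun p : {poly R} => p`_1)) := Ew.
  by rewrite coefXM coefB coef_poly coef1 /= => <-; rewrite subr0 divr1 expr1.
set e := exp_poly N.+2 2 in E2 E4 B2 B4 w Ew w0.
have scX k : (k%:R : R) *: 'X = k%:R * 'X :> {poly R}.
  by rewrite scaler_nat mulr_natl.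
rewrite (scX 2%N) in B2; rewrite (scX 4%N) in B4.
have Z : eqmodX N.+1 (h * (e + 1)) ('X * (e - 1)).
  apply: (eqmodX_mul2l w0); apply/eqmodXP.
  pose r := s4 + bernoulli_poly N.+2 4 * r4 - s2 * (e + 1).
  exists r; apply: (@mulfI _ 'X); first by rewrite polyX_eq0.
  rewrite -/Y [RHS]mulrDr.
  have Xw t : 'X * (w * t) = (e - 1) * t by rewrite Ew mulrA.
  rewrite !Xw; apply/eqP; rewrite -subr_eq0; apply/eqP.
  transitivity ((bernoulli_poly N.+2 4 * (exp_poly N.+2 4 - 1) - (4 * 'X + s4 * ('X * Y)))
    + bernoulli_poly N.+2 4 * (e * e - (exp_poly N.+2 4 + r4 * ('X * Y)))
    - (e + 1) * (bernoulli_poly N.+2 2 * (e - 1) - (2 * 'X + s2 * ('X * Y)))).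
    by rewrite /h /r; ring.
  by rewrite B2 B4 E4 !subrr; ring.
(* With e = u^2 and u v = 1, the claim multiplied by u becomes the congruence [Z]. *)
have u0 : u`_0 != 0 by rewrite coef_poly /= expr0 divr1 oner_neq0.
apply: (eqmodX_mul2l u0); move: Z => /eqmodXP[t Z]; apply/eqmodXP.
exists (t + h * (r2 + r0) * 'X + 'X * (r0 - r2) * 'X).
rewrite -/Y in Z *.
transitivity (h * (u * u) + h * (u * v)); first by ring.
transitivity ('X * (u * u) - 'X * (u * v) + (t + h * (r2 + r0) * 'X + 'X * (r0 - r2) * 'X) * Y).
  rewrite E2 E0; transitivity (h * (e + 1) + h * (r2 + r0) * ('X * Y)); first by ring.
  by rewrite Z; ring.
by ring.
Qed.

(** The formal identity (x tan x) cos x = x sin x, in the variable x^2. It follows from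
    [bernoulli_tanh] because replacing x by ix turns x tanh x into - x tan x, which is the origin of
    the sign in [tan_coef]. *)
Lemma tan_coefP (R : realType) N n : (n < N)%N ->
  \sum_(i < n.+1) tan_coef R i * ((-1) ^+ (n - i) / ((2 * (n - i))`!)%:R)
  = ('X * sin_poly N 1)`_n.
Proof.
move=> ltnN.
have := @bernoulli_tanh R N.*2; set h := _ + 'X => /= H.
set u := exp_poly _ 1 in H; set v := exp_poly _ (-1) in H.
pose c : {poly R} := \poly_(i < N.+1) (2 / ((2 * i)`!)%:R).
pose s : {poly R} := \poly_(i < N) (2 / ((2 * i + 1)`!)%:R).
have uE i : (i < N.*2.+1)%N -> u`_i = ((i`!)%:R)^-1.
  by move=> lti; rewrite coef_poly lti expr1n mul1r.
have vE i : (i < N.*2.+1)%N -> v`_i = (-1) ^+ i / (i`!)%:R.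
  by move=> lti; rewrite coef_poly lti.
have uDv : eqmodX N.*2.+1 (u + v) (c \Po 'X^2).
  move=> i lti; rewrite coefD uE ?vE // coef_comp_poly_Xn // coef_poly.
  rewrite dvdn2 -signr_odd; case: (boolP (odd i)) => io /=; first by lra.
  have lt : (i %/ 2 < N.+1)%N by lia.
  have e : (2 * (i %/ 2) = i)%N by lia.
  by rewrite lt e; lra.
have uBv : eqmodX N.*2 ('X * (u - v)) (('X * s) \Po 'X^2).
  move=> [|i] lti; rewrite coefXM coef_comp_poly_Xn //= ?coefXM //.
  rewrite coefB uE ?vE; try by lia.
  rewrite dvdn2 -signr_odd /=; case: (boolP (odd i)) => io /=.
    rewrite ifF; last by lia.
    rewrite coef_poly ifT; last by lia.
    by rewrite expr1 (_ : 2 * (i.+1 %/ 2).-1 + 1 = i)%N; [lra|lia].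
  by rewrite expr0; lra.
have {H} : eqmodX N.*2 (h * (c \Po 'X^2)) (('X * s) \Po 'X^2).
  apply: eqmodX_trans uBv; apply: eqmodX_trans H => i lti.
  rewrite !coefM; apply: eq_bigr => j _; rewrite uDv //.
  by rewrite ltnS (leq_trans (leq_subr _ _)) // ltnW.
(* Only degree 2n is compared; the other factor is even, so the odd part of [h] does not reach that
   degree. *)
rewrite -[X in X * _](poly_even_odd h) mulrDl mulrAC -!comp_polyM.
move=> /(_ n.*2); rewrite ltn_double ltnN coefD coefMX.
rewrite !coef_comp_poly_Xn // !dvdn2 odd_double /= -muln2 mulnK //.
have -> : (if (n * 2 == 0)%N then 0 else if ~~ odd (n * 2).-1
  then (odd_poly h * c)`_((n * 2).-1 %/ 2) else 0) = 0 :> R.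
  by case: ifP => // n0; rewrite ifF //; lia.
rewrite addr0 => /(_ isT) H.
have -> : ('X * sin_poly N 1)`_n = - ((-1) ^+ n / 2 * ('X * s)`_n).
  rewrite !coefXM; case: n ltnN {H} => [|n] ltnN /=; first by rewrite mulr0 oppr0.
  by rewrite !coef_poly (ltnW ltnN) expr1n exprS; field; rewrite pnatr_eq0 -lt0n fact_gt0.
rewrite -H coefM -mulNr mulr_sumr; apply: eq_bigr => -[i /= lti] _.
rewrite coef_even_poly -mul2n coef_poly (leq_ltn_trans (leq_subr _ _)); last first.
  by rewrite ltnS ltnW.
rewrite /h !coefD coefN !coef_poly coefX (_ : (2 * i < N.*2.+1)%N); last by lia.
have -> : (2 * i == 1)%N = false by lia.
rewrite addr0 /tan_coef.
have -> : 16 ^+ i = 4 ^+ (2 * i) :> R by rewrite exprM; congr (_ ^+ _); ring.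
have -> : 4 ^+ i = 2 ^+ (2 * i) :> R by rewrite exprM; congr (_ ^+ _); ring.
have -> : (-1) ^+ n = (-1) ^+ i * (-1) ^+ (n - i) :> R by rewrite -exprD subnKC.
by rewrite exprS; field; rewrite !pnatr_eq0 -!lt0n !fact_gt0.
Qed.

(** * Taylor expansions at 0 *)

(** A Taylor expansion at 0 with remainder O(x^N), one-sided and uniform on [0, 1]. Since 1 < pi/2,
    the cosine stays positive on this interval. *)
Definition jet (R : realType) (N : nat) (f : R -> R) (p : {poly R}) : Prop :=
  exists2 C : R, 0 <= C &
    forall x, 0 <= x <= 1 -> `|f x - p.[x]| <= C * x ^+ N.

Lemma poly_bound01 (R : realType) (p : {poly R}) :
  exists2 C : R, 0 <= C & forall x, 0 <= x <= 1 -> `|p.[x]| <= C.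
Proof.
elim/poly_ind: p => [|p c [C C0 pC]].
  by exists 0 => // x _; rewrite horner0 normr0.
exists (C + `|c|) => [|x xI]; first by rewrite addr_ge0.
rewrite hornerMXaddC (le_trans (ler_normD _ _)) // lerD2r normrM.
have /andP[x0 x1] := xI; rewrite (ger0_norm x0).
by rewrite (le_trans _ (pC x xI)) // ler_piMr.
Qed.

Lemma jet_le (R : realType) M N (f : R -> R) p : (M <= N)%N ->
  jet N f p -> jet M f p.
Proof.
move=> leMN [C C0 fC]; exists C => // x /[dup] xI /andP[x0 x1].
apply: le_trans (fC x xI) _; rewrite ler_wpM2l //.
exact: ler_wiXn2l.
Qed.

Lemma jet_eqmodX (R : realType) N (f : R -> R) p q :
  eqmodX N p q -> jet N f p -> jet N f q.
Proof.
move=> /eqmodXP[r ->] [C C0 fC]; have [D D0 rD] := poly_bound01 r.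
exists (C + D) => [|x xI]; first by rewrite addr_ge0.
have /andP[x0 x1] := xI.
have -> : f x - q.[x] = (f x - (q + r * 'X^N).[x]) + r.[x] * x ^+ N.
  by rewrite hornerD hornerM hornerXn; ring.
rewrite (le_trans (ler_normD _ _)) // mulrDl lerD ?fC // normrM.
rewrite [`|x ^+ N|]ger0_norm ?exprn_ge0 // ler_wpM2r ?exprn_ge0 //.
exact: rD.
Qed.

Lemma eq_jet (R : realType) N (f g : R -> R) p :
  (forall x, 0 <= x <= 1 -> f x = g x) -> jet N f p -> jet N g p.
Proof. by move=> fg [C C0 fC]; exists C => // x xI; rewrite -fg ?fC. Qed.

Lemma jetM (R : realType) N (f g : R -> R) p q :
  jet N f p -> jet N g q -> jet N (fun x => f x * g x) (p * q).
Proof.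
move=> [C C0 fC] [D D0 gD].
have [P P0 pP] := poly_bound01 p; have [Q Q0 qQ] := poly_bound01 q.
exists (C * (D + Q) + P * D) => [|x xI].
  by rewrite addr_ge0 ?mulr_ge0 // addr_ge0.
have /andP[x0 x1] := xI; have xN : 0 <= x ^+ N by rewrite exprn_ge0.
have -> : f x * g x - (p * q).[x] =
    (f x - p.[x]) * (g x - q.[x] + q.[x]) + p.[x] * (g x - q.[x]).
  by rewrite hornerM; ring.
rewrite (le_trans (ler_normD _ _)) // [leRHS]mulrDl lerD // normrM.
  rewrite mulrAC ler_pM ?fC // (le_trans (ler_normD _ _)) // lerD ?qQ //.
  by rewrite (le_trans (gD x xI)) // ler_piMr // exprn_ile1.
by rewrite -mulrA ler_pM ?pP ?gD.
Qed.

Lemma jetX (R : realType) N (f : R -> R) p k :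
  jet N f p -> jet N (fun x => f x ^+ k) (p ^+ k).
Proof.
move=> fp; elim: k => [|k IHk].
  exists 0 => // x _; by rewrite !expr0 hornerC subrr normr0 mul0r.
rewrite exprS; apply: eq_jet (jetM fp IHk) => x _; exact/esym/exprS.
Qed.

(** The mean value theorem applied to f - p, which vanishes at 0, gains one power of x. *)
Lemma jet_integral (R : realType) N (f g : R -> R) p :
  (forall x : R, 0 <= x <= 1 -> is_derive x 1 f (g x)) -> f 0 = p.[0] ->
  jet N g p^`() -> jet N.+1 f p.
Proof.
move=> df f0 [C C0 gC]; exists C => // x /andP[x0 x1].
pose h y := f y - p.[y].
have dh (y : R) : 0 <= y <= 1 -> is_derive y 1 h (g y - p^`().[y]).
  by move=> yI; have := df y yI => dfy; apply: is_deriveB.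
have [c] : exists2 c, c \in `[0, x]%R &
    h x - h 0 = (g c - p^`().[c]) * (x - 0).
  apply: (@MVT_segment _ h (fun c => g c - p^`().[c])) => // [y|].
    by rewrite in_itv /= => /andP[y0 yx]; apply: dh; rewrite !ltW // (lt_le_trans yx).
  apply: derivable_within_continuous => y; rewrite in_itv /= => /andP[y0 yx].
  by have [] := dh y; rewrite ?y0 ?(le_trans yx).
rewrite in_itv /= => /andP[c0 cx].
rewrite {2}/h f0 subrr !subr0 /h => ->.
rewrite normrM (ger0_norm x0) exprSr mulrA ler_wpM2r //.
apply: le_trans (gC c _) _; first by rewrite c0 (le_trans cx).
by rewrite ler_wpM2l // lerXn2r ?nnegrE.
Qed.

Lemma poly_small_root (R : realType) (p : {poly R}) (C : R) : 0 <= C ->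
  (forall x, 0 < x <= 1 -> `|p.[x]| <= C * x) -> p`_0 = 0.
Proof.
move=> C0 pC; have [D D0 qD] := poly_bound01 (drop_poly 1 p).
apply/eqP; rewrite -normr_le0 leNgt; apply/negP => p0.
(* Everywhere on (0, 1] the constant term is at most (C + D) x in absolute value; this x lies in (0,
   1] and violates that bound if the constant term is nonzero. *)
pose x := `|p`_0| / (C + D + `|p`_0|).
have den0 : 0 < C + D + `|p`_0| by rewrite ltr_wpDl // addr_ge0.
have x0 : 0 < x by rewrite divr_gt0.
have x1 : x <= 1 by rewrite ler_pdivrMr // mul1r lerDr addr_ge0.
have : `|p`_0| <= (C + D) * x.
  have -> : p`_0 = p.[x] - (drop_poly 1 p).[x] * x.
    rewrite -[in p.[x]](poly_take_drop 1 p) hornerD hornerM hornerXn expr1 addrK.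
    have -> : take_poly 1 p = (p`_0)%:P.
      by apply/polyP => -[|i]; rewrite coef_take_poly coefC.
    by rewrite hornerC.
  rewrite (le_trans (ler_normB _ _)) // mulrDl lerD ?pC ?x0 //.
  by rewrite normrM (gtr0_norm x0) ler_wpM2r ?(ltW x0) // qD // (ltW x0).
rewrite /x mulrA ler_pdivlMr // mulrC ler_pM2r //.
by rewrite gerDl leNgt p0.
Qed.

Lemma jet_uniq (R : realType) N (f : R -> R) p q :
  jet N f p -> jet N f q -> eqmodX N p q.
Proof.
move=> [C C0 fC] [D D0 fD].
suff H (r : {poly R}) : (forall x, 0 < x <= 1 -> `|r.[x]| <= (C + D) * x ^+ N) ->
    forall i, (i < N)%N -> r`_i = 0.
  move=> i iN; apply/eqP; rewrite -subr_eq0 -coefB; apply/eqP/H => // x /andP[x0 x1].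
  have xI : 0 <= x <= 1 by rewrite ltW.
  have -> : (p - q).[x] = (f x - q.[x]) - (f x - p.[x]).
    by rewrite hornerD hornerN; ring.
  by rewrite (le_trans (ler_normB _ _)) // addrC mulrDl lerD ?fC ?fD.
move: (C + D) (addr_ge0 C0 D0) => E E0.
elim: N r {fC fD} => // N IHN r rE.
have r0 : r`_0 = 0.
  apply: (poly_small_root E0) => x /[dup] xI /andP[x0 x1].
  apply: le_trans (rE x xI) _; rewrite ler_wpM2l // exprS.
  by rewrite ler_piMr ?(ltW x0) // exprn_ile1 // ltW.
case=> // i iN; rewrite -[i.+1]addn1 -coef_drop_poly; apply: IHN => // x /[dup] xI /andP[x0 x1].
have -> : (drop_poly 1 r).[x] = r.[x] / x.
  rewrite -{2}(poly_take_drop 1 r) hornerD hornerM hornerXn.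
  have -> : take_poly 1 r = 0.
    by apply/polyP => -[|j]; rewrite coef_take_poly coef0.
  by rewrite horner0 add0r expr1 mulfK ?gt_eqF.
by rewrite normrM normfV (gtr0_norm x0) ler_pdivrMr // -mulrA -exprSr rE.
Qed.

(** Each of the two expansions is the integral of the other up to a factor, so they are raised
    alternately by one order, starting from |cos| <= 1. *)
Lemma jet_sin_cos (R : realType) (mu : R) N :
  jet (2 * N) (fun x => cos (mu * x)) (cos_poly N mu \Po 'X^2) /\
  jet (2 * N + 1) (fun x => sin (mu * x)) ('X * (sin_poly N mu \Po 'X^2)).
Proof.
have dmul (x : R) : is_derive x 1 (fun y : R => mu * y) mu.
  by apply: (is_derive_eq (is_deriveZ mu (is_derive_id x 1))); rewrite scaler1.
have dsin (x : R) : is_derive x 1 (fun y => sin (mu * y)) (cos (mu * x) * mu).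
  exact: (@is_derive1_comp _ sin _ _ _ _ (is_derive_sin _) (dmul x)).
have dcos (x : R) : is_derive x 1 (fun y => cos (mu * y)) (- sin (mu * x) * mu).
  exact: (@is_derive1_comp _ cos _ _ _ _ (is_derive_cos _) (dmul x)).
have jetZ c n (f : R -> R) p : jet n f p -> jet n (fun x => f x * c) (c *: p).
  move=> fp; rewrite -mul_polyC mulrC; apply: jetM fp _; exists 0 => // x _.
  by rewrite hornerC subrr normr0 mul0r.
have sin_of_cos n : jet (2 * n) (fun x => cos (mu * x)) (cos_poly n mu \Po 'X^2) ->
    jet (2 * n + 1) (fun x => sin (mu * x)) ('X * (sin_poly n mu \Po 'X^2)).
  move=> /(jetZ mu) jc; rewrite addn1.
  apply: (jet_integral (fun x _ => dsin x)); first by rewrite mulr0 sin0 !hornerE.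
  congr (jet _ _ _): jc; apply/polyP => i.
  rewrite coef_deriv coefZ coefXM /= !coef_comp_poly_Xn // !coef_poly.
  case: ifP => [i2|_]; last by rewrite mul0rn mulr0.
  case: ifP => [_|_]; last by rewrite mul0rn mulr0.
  have -> : (2 * (i %/ 2) + 1 = i.+1)%N by lia.
  have -> : (2 * (i %/ 2) = i)%N by lia.
  rewrite -mulr_natr factS natrM exprS; field.
  by rewrite pnatr_eq0 -lt0n fact_gt0 nat1r pnatr_eq0.
have cos_of_sin n : jet (2 * n + 1) (fun x => sin (mu * x)) ('X * (sin_poly n mu \Po 'X^2)) ->
    jet (2 * n.+1) (fun x => cos (mu * x)) (cos_poly n.+1 mu \Po 'X^2).
  move=> /(jetZ (- mu)) js; have -> : (2 * n.+1 = (2 * n + 1).+1)%N by lia.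
  apply: (jet_integral (g := fun x => sin (mu * x) * - mu)) => [x _||].
  - by apply: is_derive_eq (dcos x) _; ring.
  - rewrite mulr0 cos0 horner_coef0 coef_comp_poly_Xn // coef_poly /=.
    by rewrite !expr0 !mulr1 divr1.
  congr (jet _ _ _): js; apply/polyP => i.
  rewrite coef_deriv coefZ coefXM !coef_comp_poly_Xn //.
  case: i => [|i] /=; first by rewrite mulr0 mul0rn.
  rewrite !coef_poly.
  have -> : (2 %| i.+2)%N = (2 %| i)%N by lia.
  case: ifP => [i2|_]; last by rewrite mul0rn mulr0.
  have -> : (i.+2 %/ 2)%N = (i %/ 2).+1 by lia.
  rewrite ltnS; case: ifP => [_|_]; last by rewrite mul0rn mulr0.
  have -> : (2 * (i %/ 2) + 1 = i.+1)%N by lia.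
  have -> : (2 * (i %/ 2).+1 = i.+2)%N by lia.
  rewrite -mulr_natr [in RHS]factS natrM !exprS; field.
  by rewrite -natrD !pnatr_eq0 -lt0n fact_gt0.
suff H n : jet (2 * n) (fun x => cos (mu * x)) (cos_poly n mu \Po 'X^2).
  by split; [exact: H|exact/sin_of_cos/H].
elim: n => [|n /sin_of_cos/cos_of_sin //].
exists 1 => // x _; rewrite /cos_poly poly_def big_ord0 comp_poly0 horner0 subr0.
by rewrite expr0 mulr1 cos_max.
Qed.

(** * The expansion of the logarithm of the cosine *)

Definition antideriv (R : realType) (p : {poly R}) : {poly R} :=
  \poly_(i < (size p).+1) (p`_i.-1 / i%:R).

Lemma antiderivK (R : realType) (p : {poly R}) : (antideriv p)^`() = p.
Proof.
apply/polyP => i; rewrite coef_deriv -mulr_natr coef_poly ltnS /=.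
by case: ltnP => [_|le]; rewrite ?divfK ?pnatr_eq0 // mul0r nth_default.
Qed.

Lemma antideriv_coef0 (R : realType) (p : {poly R}) : (antideriv p)`_0 = 0.
Proof. by rewrite coef_poly invr0 mulr0. Qed.

(** The Picard iterates of tan' = 1 + tan^2, tan 0 = 0. Each iteration gains one order of accuracy
    and keeps the coefficients nonnegative. *)
Fixpoint tan_poly (R : realType) (N : nat) : {poly R} :=
  if N is n.+1 then antideriv (1 + tan_poly R n ^+ 2) else 0.

Lemma tan_poly_ge0 (R : realType) N i : 0 <= (tan_poly R N)`_i.
Proof.
elim: N i => [|N IHN] i; first by rewrite coef0.
rewrite coef_poly; case: ifP => // _; rewrite divr_ge0 // coefD coef1.
rewrite addr_ge0 // expr2 coefM sumr_ge0 // => j _; exact: mulr_ge0.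
Qed.

Lemma cos_gt0_01 (R : realType) (x : R) : 0 <= x <= 1 -> 0 < cos x.
Proof.
move=> /andP[x0 x1]; have h1 : 1 < pi / 2 :> R.
  rewrite lt_neqAle pihalf_ge1 andbT; apply/eqP => e.
  by have := @cos1_gt0 R; rewrite e cos_pihalf ltxx.
apply: cos_gt0_pihalf; rewrite (le_lt_trans x1 h1) andbT.
by rewrite (lt_le_trans _ x0) // oppr_lt0 (lt_trans ltr01).
Qed.

Lemma jet_tan (R : realType) N : jet N (@tan R) (tan_poly R N).
Proof.
elim: N => [|N IHN].
  exists (cos 1)^-1 => [|x xI].
    by rewrite invr_ge0 ltW // cos_gt0_01 // ler01 lexx.
  rewrite horner0 subr0 expr0 mulr1 /tan normrM.
  rewrite -[leRHS]mul1r ler_pM ?sin_max // normfV gtr0_norm ?cos_gt0_01 //.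
  rewrite lef_pV2 ?posrE ?cos_gt0_01 ?ler01 ?lexx //.
  have /andP[x0 x1] := xI; have pi1 : 1 <= pi :> R.
    by rewrite (le_trans _ (pi_ge2 R)) // ler1n.
  rewrite leNgt ltr_cos -?leNgt // in_itv /= ?x0 ?ler01 //.
  exact: le_trans pi1.
apply: (@jet_integral _ N _ (fun x => (cos x) ^- 2)) => [x xI||].
- by apply: is_derive_tan; rewrite gt_eqF ?cos_gt0_01.
- by rewrite tan0 horner_coef0 antideriv_coef0.
rewrite antiderivK; have [C C0 h] := jetX 2 IHN; exists C => // x xI.
rewrite cos2_tan2 ?gt_eqF ?cos_gt0_01 // hornerD hornerC.
by rewrite opprD addrACA subrr add0r h.
Qed.

(** Both sides, multiplied by the cosine polynomial, give x sin x modulo x^N: the left one by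
    uniqueness of the expansion of tan x cos x = sin x, the right one by [tan_coefP]. The cosine
    polynomial then cancels. *)
Lemma tan_poly_eqmodX (R : realType) N :
  eqmodX N ('X * tan_poly R N) ((\poly_(i < N) tan_coef R i) \Po 'X^2).
Proof.
set A := \poly_(i < N) _.
have E1 : eqmodX N (tan_poly R N * (cos_poly N 1 \Po 'X^2))
                   ('X * (sin_poly N 1 \Po 'X^2)).
  have [jc js] := jet_sin_cos (1 : R) N.
  apply: (@jet_uniq _ N (fun x => tan x * cos (1 * x))).
    by apply: jetM (jet_tan R N) (jet_le _ jc); rewrite mul2n -addnn leq_addr.
  apply: (@eq_jet _ N (fun x => sin (1 * x))) => [x xI|].
    by rewrite mul1r /tan divfK // gt_eqF ?cos_gt0_01.
  by apply: jet_le js; lia.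
have E2 : eqmodX N (A * cos_poly N 1) ('X * sin_poly N 1).
  move=> n ltnN; rewrite -tan_coefP // coefM; apply: eq_bigr => -[i /= lti] _.
  rewrite !coef_poly (leq_ltn_trans (leq_subr _ _)) ?(leq_trans lti) //.
  by rewrite expr1n mulr1.
have E3 : eqmodX N ((A * cos_poly N 1) \Po 'X^2) (('X * sin_poly N 1) \Po 'X^2).
  move=> n ltnN; rewrite !coef_comp_poly_Xn //; case: ifP => // _; apply: E2.
  exact: leq_ltn_trans (leq_div _ _) ltnN.
(* The truncation [cos_poly 0 1] is the zero polynomial, hence the exception. *)
have c0 : (cos_poly N 1 \Po 'X^2)`_0 != 0 :> R \/ N = 0%N.
  rewrite coef_comp_poly_Xn // coef_poly; case: N {A E1 E2 E3} => [|N]; [by right|left].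
  by rewrite /= expr0 mul1r expr0 divr1 oner_neq0.
case: c0 => [c0|->]; last by [].
apply: (eqmodX_mul2l c0).
apply: (@eqmodX_trans _ _ _ ('X * ('X * (sin_poly N 1 \Po 'X^2)))).
  case=> [|i] iN; first by rewrite mulrCA !coefXM.
  by rewrite mulrCA !(coefXM _ i.+1) mulrC E1 // ltnW.
have -> : 'X * ('X * (sin_poly N 1 \Po 'X^2)) = ('X * sin_poly N 1) \Po 'X^2 :> {poly R}.
  by rewrite comp_polyM comp_polyX mulrA -expr2.
by apply: eqmodX_sym; rewrite mulrC -comp_polyM.
Qed.

Lemma tan_coef_ge0 (R : realType) m : 0 <= tan_coef R m.
Proof.
have := @tan_poly_eqmodX R m.*2.+1 m.*2 (leqnn _).
rewrite coef_comp_poly_Xn // dvdn2 odd_double /= -muln2 mulnK // coef_poly.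
rewrite ifT; last by lia.
by move=> <-; rewrite coefXM; case: ifP => // _; exact: (tan_poly_ge0 _ (m * 2).+1).
Qed.

(** By [tan_coef_ge0] the coefficient equals its absolute value, which replaces the sign and the
    Bernoulli number by |B_(2m)|. The factor 2m comes from differentiating the series of - ln
    cos. *)
Lemma tan_coef_alpha (R : realType) m :
  tan_coef R m = (2 * m)%:R * alpha R m.
Proof.
rewrite -[LHS]ger0_norm ?tan_coef_ge0 // /tan_coef /alpha !normrM normfV normr_nat.
rewrite normr_sign mul1r.
have -> : 16 ^+ m - 4 ^+ m = (4 ^+ m - 1) * 2 ^+ (2 * m) :> R.
  rewrite (exprM 2) -(_ : 4 = 2 ^+ 2); last by ring.
  by rewrite mulrBl mul1r -exprMn; congr (_ ^+ _ - _); ring.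
rewrite [`|_ * _|]ger0_norm; last first.
  by rewrite mulr_ge0 ?exprn_ge0 // subr_ge0 exprn_ege1 // ler1n.
case: m => [|m]; first by rewrite muln0 mul0r expr0 subrr !mul0r.
by field; rewrite nat1r !pnatr_eq0 -lt0n fact_gt0.
Qed.

Lemma tan_coef1 (R : realType) : tan_coef R 1 = 1.
Proof.
have t0 : tan_coef R 0 = 0 by rewrite /tan_coef !expr0 subrr mulr0 !mul0r.
have := @tan_coefP R 2 1 isT.
rewrite 2!big_ord_recr big_ord0 /= t0 mul0r !add0r subnn muln0 !expr0 divr1 mulr1.
by move=> ->; rewrite coefXM coef_poly /= muln0 expr1n expr0 divr1 mulr1.
Qed.

Lemma coef_gen_trunc (R : realType) (x : nat -> R) N m :
  (gen_trunc x N)`_m = if (0 < m <= N)%N then x m else 0.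
Proof.
rewrite /gen_trunc coef_sum -[(m <= N)%N]ltnS -(big_nat1_eq +%R x) [RHS]big_mkcond.
by apply: eq_bigr => i _; rewrite coefZ coefXn eq_sym; case: eqP; rewrite ?mulr1 ?mulr0.
Qed.

Definition rho (R : realType) (x : R) : R := - ln (cos x) - x ^+ 2 / 2.

Lemma jet_rho (R : realType) N :
  jet (2 * N + 4) (@rho R)
      (('X * gen_trunc (fun m => alpha R m.+1) N) \Po 'X^2).
Proof.
have drho (x : R) : 0 <= x <= 1 -> is_derive x 1 (@rho R) (tan x - x).
  move=> xI; have c0 := cos_gt0_01 xI.
  have d1 : is_derive x 1 (fun y => ln (cos y)) ((cos x)^-1 * - sin x).
    exact: (@is_derive1_comp _ (@ln R) (@cos R) _ _ _ (is_derive1_ln c0) (is_derive_cos x)).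
  have d2 : is_derive x 1 (fun y : R => y ^+ 2 / 2) x.
    have -> : (fun y : R => y ^+ 2 / 2) = horner ((2^-1)%:P * 'X^2).
      by apply/funext => y; rewrite hornerCM hornerXn [RHS]mulrC.
    apply: (is_derive_eq (is_derive_poly _ _)).
    by rewrite derivM derivC derivXn mul0r add0r hornerCM hornerMn hornerXn expr1; field.
  have d3 := is_deriveB (is_deriveN d1) d2.
  by apply: (is_derive_eq d3); rewrite /tan; ring.
have -> : (2 * N + 4 = (2 * N + 3).+1)%N by lia.
apply: (jet_integral drho).
  rewrite /rho cos0 ln1 oppr0 expr0n mul0r subrr comp_polyM comp_polyX.
  by rewrite hornerM hornerXn expr0n mul0r.
(* The iterate is one order finer than the remainder because [tan_poly_eqmodX] describes x tan x,
   whose degrees are shifted by one. *)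
have jt : jet (2 * N + 3) (fun x => tan x - x) (tan_poly R (2 * N + 4) - 'X).
  have [C C0 h] := jet_le (leqnSn _ : (_ <= (2 * N + 3).+1)%N) (jet_tan R (2 * N + 3).+1).
  exists C => // x xI; rewrite !hornerE opprB addrA subrK.
  by rewrite addnS; apply: h.
apply: jet_eqmodX jt => i lti.
have := @tan_poly_eqmodX R (2 * N + 4) i.+1.
rewrite coefXM /= coefB => ->; last by lia.
rewrite coef_comp_poly_Xn // coef_poly coef_deriv comp_polyM comp_polyX.
rewrite coefXnM coefX coef_comp_poly_Xn //.
case: (boolP (odd i)) => io; last first.
  rewrite ifF; last by lia.
  rewrite [X in _ = X *+ _](_ : _ = 0); last by case: ifP => // h; rewrite ifF //; lia.
  by rewrite mul0rn (_ : (i == 1%N) = false) ?subr0 //; lia.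
have [m iE lemN] : exists2 m, i = m.*2.+1 & (m <= N)%N by exists i./2; lia.
rewrite {}iE {i lti io}.
rewrite (_ : (2 %| m.*2.+2)%N); last by lia.
have -> : (m.*2.+2 %/ 2 = m.+1)%N by lia.
rewrite (_ : (m.+1 < 2 * N + 4)%N); last by lia.
rewrite (_ : (m.*2.+2 < 2)%N = false) // (_ : (2 %| m.*2.+2 - 2)%N); last by lia.
have -> : ((m.*2.+2 - 2) %/ 2 = m)%N by lia.
(* In degree one the leading term of the tangent cancels against the subtracted ['X]; this is why
   the series of [rho] starts with alpha(2). *)
rewrite coef_gen_trunc lemN andbT; case: m {lemN} => [|m].
  by rewrite tan_coef1 subrr mul0rn.
rewrite tan_coef_alpha (_ : (m.+1.*2.+1 == 1)%N = false) // subr0 -[RHS]mulr_natl.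
by congr (_%:R * _); lia.
Qed.

(** * The Fourier integral *)

Definition integral_pihalf (R : realType) (f : R -> R) : R :=
  \int[@lebesgue_measure R]_(x in `[0, pi / 2]) f x.

Lemma eq_integral_pihalf (R : realType) (f g : R -> R) :
  f =1 g -> integral_pihalf f = integral_pihalf g.
Proof. by move=> /funext ->. Qed.

Lemma pihalf_gt0 (R : realType) : 0 < pi / 2 :> R.
Proof. by rewrite divr_gt0 ?pi_gt0. Qed.

Lemma integrable_pihalf (R : realType) (f : R -> R) : continuous f ->
  (@lebesgue_measure R).-integrable `[0, pi / 2] (EFin \o f).
Proof.
move=> cf; apply: continuous_compact_integrable; first exact: segment_compact.
exact: continuous_subspaceT.
Qed.

Lemma integral_pihalfD (R : realType) (f g : R -> R) :
  continuous f -> continuous g ->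
  integral_pihalf (fun x => f x + g x) = integral_pihalf f + integral_pihalf g.
Proof. by move=> cf cg; apply: RintegralD => //; exact: integrable_pihalf. Qed.

Lemma integral_pihalfZ (R : realType) c (f : R -> R) : continuous f ->
  integral_pihalf (fun x => c * f x) = c * integral_pihalf f.
Proof. by move=> cf; apply: RintegralZl => //; exact: integrable_pihalf. Qed.

Lemma continuous_sum (R : realType) n (f : nat -> R -> R) :
  (forall i, continuous (f i)) -> continuous (fun x => \sum_(i < n) f i x).
Proof.
move=> cf; elim: n => [|n IHn].
  by under eq_fun do rewrite big_ord0; exact: cst_continuous.
under eq_fun do rewrite big_ord_recr /=.
by move=> x; apply: cvgD; [exact: IHn|exact: cf].
Qed.

Lemma integral_pihalf_sum (R : realType) n (f : nat -> R -> R) :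
  (forall i, continuous (f i)) ->
  integral_pihalf (fun x => \sum_(i < n) f i x) =
  \sum_(i < n) integral_pihalf (f i).
Proof.
move=> cf; elim: n => [|n IHn].
  under eq_fun do rewrite big_ord0.
  by rewrite big_ord0 /integral_pihalf Rintegral_cst // mul0r.
rewrite big_ord_recr /= -IHn -integral_pihalfD //; last exact: continuous_sum.
by apply: eq_integral_pihalf => x; rewrite big_ord_recr.
Qed.

Lemma le_integral_pihalf (R : realType) (f g : R -> R) :
  continuous f -> continuous g ->
  (forall x, 0 <= x <= pi / 2 -> f x <= g x) ->
  integral_pihalf f <= integral_pihalf g.
Proof.
by move=> cf cg fg; apply: le_Rintegral => //; exact: integrable_pihalf.
Qed.

Lemma integral_pihalf_FTC (R : realType) (f F : R -> R) :
  continuous f -> (forall x : R, is_derive x 1 F (f x)) ->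
  integral_pihalf f = F (pi / 2) - F 0.
Proof.
move=> cf dF; rewrite /integral_pihalf /Rintegral.
have cF : continuous F.
  by move=> x; apply/differentiable_continuous/derivable1_diffP; case: (dF x).
rewrite (@continuous_FTC2 _ f F) ?pihalf_gt0 //; first exact: continuous_subspaceT.
- split=> [x _||]; first by case: (dF x).
    by apply: cvg_at_right_filter; exact: cF.
  by apply: cvg_at_left_filter; exact: cF.
- by move=> x _; rewrite derive1E; case: (dF x).
Qed.

Lemma is_derive_mulr (R : realType) (f : R -> R) (df c x : R) :
  is_derive x 1 f df -> is_derive x 1 (fun y => f y * c) (df * c).
Proof.
move=> d; have -> : (fun y => f y * c) = c \*: f.
  by apply/funext => y; rewrite [RHS]mulrC.
by apply: (is_derive_eq (is_deriveZ c d)); rewrite [LHS]mulrC.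
Qed.

Lemma sin_nat_pi (R : realType) m : sin (m%:R * pi) = 0 :> R.
Proof.
elim: m => [|m IHm]; first by rewrite mul0r sin0.
by rewrite mulrS mulrDl mul1r addrC sinDpi IHm oppr0.
Qed.

Definition cos_sin_integral (R : realType) (m n : nat) : R :=
  integral_pihalf (fun x : R => cos x ^+ n * (sin x * sin (m%:R * x))).

Lemma continuous_mull (R : realType) (c : R) : continuous (fun x : R => c * x).
Proof. by move=> x; apply: cvgM; [exact: cvg_cst|exact: cvg_id]. Qed.

Lemma continuous_sin_mul (R : realType) (c : R) :
  continuous (fun x : R => sin (c * x)).
Proof.
by move=> x; apply: (@continuous_comp _ _ _ (fun x : R => c * x) sin);
  [exact: continuous_mull|exact: continuous_sin].
Qed.

Lemma continuous_exprn (R : realType) (f : R -> R) n :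
  continuous f -> continuous (fun x => f x ^+ n).
Proof.
move=> cf x; apply: (@continuous_comp _ _ _ f (fun y => y ^+ n)).
  exact: cf.
exact: exprn_continuous.
Qed.

Lemma continuous_cos_sin (R : realType) (c : R) n :
  continuous (fun x : R => cos x ^+ n * (sin x * sin (c * x))).
Proof.
move=> x; apply: cvgM; first exact: (continuous_exprn (@continuous_cos R)).
by apply: cvgM; [exact: continuous_sin|exact: continuous_sin_mul].
Qed.

(** Writing 2 cos x sin((m+1)x) as a sum of sines gives the last-step recurrence, up to the factor
    1/2 per step. The vanishing of the integral for m = 0 then plays the part of the barrier. *)
Lemma cos_sin_integralS (R : realType) m n :
  cos_sin_integral R m.+1 n.+1 =
  (cos_sin_integral R m.+2 n + cos_sin_integral R m n) / 2.
Proof.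
rewrite /cos_sin_integral -integral_pihalfD; try exact: continuous_cos_sin.
rewrite mulrC -integral_pihalfZ; last first.
  by move=> x; apply: cvgD; exact: continuous_cos_sin.
apply: eq_integral_pihalf => x.
have -> : m.+2%:R * x = m.+1%:R * x + x by rewrite [m.+2%:R]mulrS; ring.
have -> : m%:R * x = m.+1%:R * x - x by rewrite [m.+1%:R]mulrS; ring.
by rewrite sinB sinD exprS; field.
Qed.

Lemma cos_sin_integral0 (R : realType) n : cos_sin_integral R 0 n = 0.
Proof.
rewrite /cos_sin_integral.
rewrite (@eq_integral_pihalf _ _ (fun=> 0)) => [|x]; last first.
  by rewrite mul0r sin0 !mulr0.
by rewrite /integral_pihalf Rintegral_cst // mul0r.
Qed.

Lemma is_derive_sin_mul (R : realType) (c x : R) :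
  is_derive x 1 (fun y : R => sin (c * y)) (cos (c * x) * c).
Proof.
have d : is_derive x 1 (fun y : R => c * y) c.
  by apply: (is_derive_eq (is_deriveZ c (is_derive_id x 1))); rewrite scaler1.
exact: (@is_derive1_comp _ (@sin R) _ _ _ _ (is_derive_sin _) d).
Qed.

(** Orthogonality of sines on [0, pi/2] works here because l and l+2 are even, so sin(l x) and
    sin((l+2) x) vanish at both ends. *)
Lemma cos_sin_integral_base (R : realType) l : ~~ odd l ->
  cos_sin_integral R l.+1 0 = (l == 0%N)%:R * (pi / 4).
Proof.
move=> lodd; have lE : l = l./2.*2 by lia.
have sinE (x : R) : cos x ^+ 0 * (sin x * sin (l.+1%:R * x)) =
    (cos (l%:R * x) - cos (l.+2%:R * x)) / 2.
  have -> : l.+2%:R * x = l.+1%:R * x + x by rewrite [l.+2%:R]mulrS; ring.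
  have -> : l%:R * x = l.+1%:R * x - x by rewrite [l.+1%:R]mulrS; ring.
  by rewrite cosB cosD expr0; field.
have pihalf k : sin (k.*2%:R * (pi / 2)) = 0 :> R.
  by rewrite -muln2 natrM -mulrA (mulrC 2) divfK // sin_nat_pi.
rewrite /cos_sin_integral.
pose G (x : R) : R := if l == 0%N then x / 2 else sin (l%:R * x) / (2 * l%:R).
have dG (x : R) : is_derive x 1 (fun x => G x - sin (l.+2%:R * x) / (2 * l.+2%:R))
    (cos x ^+ 0 * (sin x * sin (l.+1%:R * x))).
  have d2 : is_derive x 1 (fun x : R => sin (l.+2%:R * x) / (2 * l.+2%:R))
      (cos (l.+2%:R * x) / 2).
    apply: (is_derive_eq (is_derive_mulr _ (is_derive_sin_mul _ _))); field.
    by rewrite -natrD pnatr_eq0.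
  have d1 : is_derive x 1 G (cos (l%:R * x) / 2).
    rewrite /G; case: eqP => [->|/eqP l0].
      by apply: (is_derive_eq (is_derive_mulr _ (is_derive_id _ _))); rewrite mul0r cos0.
    apply: (is_derive_eq (is_derive_mulr _ (is_derive_sin_mul _ _))); field.
    by rewrite pnatr_eq0.
  by apply: (is_derive_eq (is_deriveB d1 d2)); rewrite sinE; ring.
rewrite (integral_pihalf_FTC (@continuous_cos_sin _ _ _) dG).
rewrite !mulr0 sin0 mul0r subr0 lE -doubleS pihalf mul0r subr0 -lE /G.
case: eqP => [_|l0]; first by rewrite mul0r subr0 mul1r; field.
by rewrite mulr0 sin0 !mul0r lE pihalf mul0r subrr.
Qed.

Lemma cos_sin_integral_walk_count (R : realType) lambda n :
  n = lambda %[mod 2] ->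
  cos_sin_integral R lambda.+1 n = pi / 2 ^+ n.+2 * (walk_count lambda n)%:R.
Proof.
elim: n lambda => [|n IHn] lambda nl.
  rewrite cos_sin_integral_base; last by lia.
  by rewrite /= mulrC (_ : 2 ^+ 2 = 4) //; ring.
rewrite cos_sin_integralS IHn /= ?natrD; last by lia.
case: lambda nl => [|l] nl.
  by rewrite cos_sin_integral0 [2 ^+ n.+3]exprS; field; rewrite expf_neq0.
rewrite IHn; last by lia.
by rewrite [2 ^+ n.+3]exprS; field; rewrite expf_neq0.
Qed.

(** * Gaussian integrals on a bounded interval *)

Lemma le_is_derive (R : realType) (h dh : R -> R) (a b : R) : a <= b ->
  (forall x : R, a <= x <= b -> is_derive x 1 h (dh x)) ->
  (forall x : R, a <= x <= b -> 0 <= dh x) -> h a <= h b.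
Proof.
move=> ab hd dh0; rewrite -subr_ge0.
have [x xab ->] : exists2 c, c \in `[a, b]%R & h b - h a = dh c * (b - a).
  apply: MVT_segment => // [x|].
    by rewrite in_itv /= => /andP[ax xb]; apply: hd; rewrite !ltW.
  apply: derivable_within_continuous => x; rewrite in_itv /= => xab.
  by case: (hd x xab).
by rewrite mulr_ge0 ?subr_ge0 // dh0 // !(itvP xab).
Qed.

Definition gauss_primitive (R : realType) (y : R) : R :=
  \int[@lebesgue_measure R]_(x in `[0, y]) gauss_fun x.

Lemma is_derive_gauss_primitive (R : realType) (y : R) : 0 < y ->
  is_derive y 1 (@gauss_primitive R) (gauss_fun y).
Proof.
move=> y0.
have [] := @continuous_FTC1_closed R gauss_fun 0 y (y + 1).
- by rewrite ltrDl.
- apply: continuous_compact_integrable; first exact: segment_compact.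
  exact/continuous_subspaceT/continuous_gauss_fun.
- exact: y0.
- exact: continuous_gauss_fun.
move=> d e; apply: DeriveDef; first exact: d.
by rewrite -derive1E; exact: e.
Qed.

(** The library gives the limit pi/4 of the square, and the primitive is nonnegative. *)
Lemma cvg_gauss_primitive (R : realType) :
  gauss_primitive y @[y --> +oo] --> (Num.sqrt pi / 2 : R).
Proof.
have : Num.sqrt (gauss_primitive y ^+ 2) @[y --> +oo] --> Num.sqrt (pi / 4 : R).
  apply: continuous_cvg; first exact: sqrt_continuous.
  exact: gauss_integral_proof.cvg_integral0_gauss_sqr.
rewrite sqrtrM ?pi_ge0 // sqrtrV // (_ : 4 = 2 ^+ 2); last by ring.
rewrite sqrtr_sqr ger0_norm // (_ : (fun y => Num.sqrt _) = @gauss_primitive R) //.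
apply/funext => y; rewrite sqrtr_sqr ger0_norm //.
exact: gauss_integral_proof.integral0_gauss_ge0.
Qed.

(* [y ^ 2 >= y - 1] bounds the Gaussian density by [expR (1 - y)]. *)
Lemma gauss_primitive_tail (R : realType) (y : R) : 0 < y ->
  `|Num.sqrt pi / 2 - gauss_primitive y| <= expR (1 - y).
Proof.
move=> y0.
have dexp (x : R) : is_derive x 1 (fun z : R => expR (1 - z)) (- expR (1 - x)).
  have d : is_derive x 1 (fun z : R => 1 - z) (0 - 1).
    by apply: is_deriveB.
  apply: (is_derive_eq (@is_derive1_comp _ expR _ _ _ _ (is_derive_expR _) d)).
  by rewrite sub0r mulrN1.
have up z : y <= z -> gauss_primitive y <= gauss_primitive z.
  move=> yz; apply: (@le_is_derive _ _ gauss_fun) => // x; last by rewrite gauss_fun_ge0.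
  by move=> /andP[yx _]; apply: is_derive_gauss_primitive; exact: lt_le_trans yx.
(* The function - [gauss_primitive] x - e^(1-x) is nondecreasing, its derivative being e^(1-x) -
   e^(-x^2). *)
have low z : y <= z -> gauss_primitive z <= gauss_primitive y + expR (1 - y).
  move=> yz; have e0 := expR_ge0 (1 - z).
  suff : - gauss_primitive y - expR (1 - y) <= - gauss_primitive z - expR (1 - z).
    by lra.
  apply: (@le_is_derive _ (fun x => - gauss_primitive x - expR (1 - x))
    (fun x => - gauss_fun x - - expR (1 - x))) => // x /andP[yx _].
    have x0 := lt_le_trans y0 yx.
    exact: (is_deriveB (is_deriveN (is_derive_gauss_primitive x0)) (dexp x)).
  by rewrite opprK addrC subr_ge0 /gauss_fun ler_expR; nra.
have le1 : gauss_primitive y <= Num.sqrt pi / 2.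
  apply: (@ler_cvg_to _ (+oo : set_system R) _ _ (cst (gauss_primitive y)) (@gauss_primitive R)).
  - exact: cvg_cst.
  - exact: cvg_gauss_primitive.
  - by near=> z; apply: up; near: z; apply: nbhs_pinfty_ge; exact: num_real.
have le2 : Num.sqrt pi / 2 <= gauss_primitive y + expR (1 - y).
  apply: (@ler_cvg_to _ (+oo : set_system R) _ _ (@gauss_primitive R)
    (cst (gauss_primitive y + expR (1 - y)))).
  - exact: cvg_gauss_primitive.
  - exact: cvg_cst.
  - by near=> z; apply: low; near: z; apply: nbhs_pinfty_ge; exact: num_real.
by rewrite ger0_norm ?subr_ge0 // lerBlDl.
Unshelve. all: by end_near. Qed.

Definition gauss_weight (R : realType) (n : nat) (x : R) : R :=
  expR (- (n%:R * (x ^+ 2 / 2))).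

Lemma continuous_gauss_weight (R : realType) n : continuous (@gauss_weight R n).
Proof.
suff : continuous (expR \o (fun x : R => - (n%:R * (x ^+ 2 / 2)))) by [].
move=> x; apply: continuous_comp; last exact: continuous_expR.
apply: cvgN; apply: cvgM; first exact: cvg_cst.
by apply: cvgM; [exact: exprn_continuous|exact: cvg_cst].
Qed.

Lemma is_derive_exprn (R : realType) n (x : R) :
  is_derive x 1 (fun y : R => y ^+ n) (n%:R * x ^+ n.-1).
Proof.
have -> : (fun y : R => y ^+ n) = horner 'X^n.
  by apply/funext => y; rewrite hornerXn.
apply: (is_derive_eq (is_derive_poly _ _)).
by rewrite derivXn hornerMn hornerXn mulr_natl.
Qed.

Lemma is_derive_gauss_weight (R : realType) n (x : R) :
  is_derive x 1 (@gauss_weight R n) (- (n%:R * x) * gauss_weight n x).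
Proof.
have d : is_derive x 1 (fun x : R => - (n%:R * (x ^+ 2 / 2))) (- (n%:R * x)).
  rewrite (_ : (fun x : R => _) = (fun x => x ^+ 2 * - (n%:R / 2))); last first.
    by apply/funext => z; field.
  by apply: (is_derive_eq (is_derive_mulr _ (is_derive_exprn 2 x))); rewrite expr1; field.
apply: (is_derive_eq (@is_derive1_comp _ expR _ _ _ _ (is_derive_expR _) d)).
exact: mulrC.
Qed.

Definition gauss_int (R : realType) (i n : nat) : R :=
  integral_pihalf (fun x : R => x ^+ (2 * i) * gauss_weight n x).

(** Integration by parts, written as the integral of the derivative of x^(2i+1) e^(-n x^2/2). It is
    the recurrence of the Gaussian moments up to a boundary term at pi/2. *)
Lemma gauss_intS (R : realType) i n :
  n%:R * gauss_int R i.+1 n = (2 * i + 1)%:R * gauss_int R i n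
    - (pi / 2) ^+ (2 * i + 1) * gauss_weight n (pi / 2).
Proof.
pose f (x : R) : R := (2 * i + 1)%:R * (x ^+ (2 * i) * gauss_weight n x)
  + - n%:R * (x ^+ (2 * i.+1) * gauss_weight n x).
have cw j : continuous (fun x : R => x ^+ (2 * j) * gauss_weight n x).
  by move=> x; apply: cvgM; [exact: exprn_continuous|exact: continuous_gauss_weight].
have cZ (c : R) j : continuous (fun x : R => c * (x ^+ (2 * j) * gauss_weight n x)).
  by move=> x; apply: cvgM; [exact: cvg_cst|exact: cw].
have df (x : R) : is_derive x 1 (fun x => x ^+ (2 * i + 1) * gauss_weight n x) (f x).
  apply: (is_derive_eq (is_deriveM (is_derive_exprn (2 * i + 1) x) (is_derive_gauss_weight n x))).
  rewrite /f /GRing.scale /= addn1 /= mulnS !exprS; ring.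
have : integral_pihalf f = (pi / 2) ^+ (2 * i + 1) * gauss_weight n (pi / 2).
  rewrite (integral_pihalf_FTC _ df).
    by rewrite expr0n addn1 /= mul0r subr0.
  by move=> x; apply: cvgD; exact: cZ.
rewrite /f integral_pihalfD // !integral_pihalfZ // -!/(gauss_int _ _ _) => <-.
by ring.
Qed.

(** u n = O(n^(-L)), with a bound for all n > 0 instead of eventually, so that estimates combine by
    adding constants. *)
Definition decay (R : realType) (L : nat) (u : nat -> R) : Prop :=
  exists2 C : R, 0 <= C & forall n, (0 < n)%N -> `|u n| * n%:R ^+ L <= C.

Lemma decay_le (R : realType) L (u v : nat -> R) :
  (forall n, (0 < n)%N -> `|u n| <= `|v n|) -> decay L v -> decay L u.
Proof.
move=> uv [C C0 vC]; exists C => // n n0; apply: le_trans (vC n n0).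
by rewrite ler_wpM2r ?exprn_ge0 // uv.
Qed.

Lemma decayD (R : realType) L (u v : nat -> R) :
  decay L u -> decay L v -> decay L (fun n => u n + v n).
Proof.
move=> [C C0 uC] [D D0 vD]; exists (C + D) => [|n n0]; first exact: addr_ge0.
apply: le_trans (lerD (uC n n0) (vD n n0)); rewrite -mulrDl.
by rewrite ler_wpM2r ?exprn_ge0 // ler_normD.
Qed.

Lemma decayZ (R : realType) L c (u : nat -> R) :
  decay L u -> decay L (fun n => c * u n).
Proof.
move=> [C C0 uC]; exists (`|c| * C) => [|n n0]; first exact: mulr_ge0.
by rewrite normrM -mulrA ler_wpM2l ?uC.
Qed.

Lemma decay_sum (R : realType) L m (u : nat -> nat -> R) :
  (forall i, (i < m)%N -> decay L (u i)) ->
  decay L (fun n => \sum_(i < m) u i n).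
Proof.
elim: m => [|m IHm] ud.
  by exists 0 => // n _; rewrite big_ord0 normr0 mul0r.
have d := decayD (IHm (fun i im => ud i (ltnW im))) (ud m (leqnn _)).
by apply: decay_le d => n _; rewrite big_ord_recr.
Qed.

Lemma decayXn (R : realType) L k (u : nat -> R) :
  decay (L + k) u -> decay L (fun n => n%:R ^+ k * u n).
Proof.
move=> [C C0 uC]; exists C => // n n0; apply: le_trans (uC n n0).
by rewrite normrM [`|_ ^+ k|]ger0_norm ?exprn_ge0 // exprD [_ ^+ k * _]mulrC mulrAC mulrA.
Qed.

Lemma decayVXn (R : realType) L k (u : nat -> R) :
  decay L u -> decay (L + k) (fun n => u n / n%:R ^+ k).
Proof.
move=> [C C0 uC]; exists C => // n n0; apply: le_trans (uC n n0).
have nk : n%:R ^+ k != 0 :> R by rewrite expf_neq0 // pnatr_eq0 -lt0n.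
rewrite normrM normfV [`|_ ^+ k|]ger0_norm ?exprn_ge0 // exprD.
by rewrite -mulrA [_^-1 * _]mulrC mulfK.
Qed.

Lemma expRN_mulXn_le (R : realType) (x : R) L : 0 <= x ->
  expR (- x) * x ^+ L <= (L`!)%:R.
Proof.
move=> x0; rewrite expRN mulrC ler_pdivrMr ?expR_gt0 // mulrC.
rewrite -ler_pdivrMr ?ltr0n ?fact_gt0 //.
case: L => [|L]; first by rewrite expr0 divr1 -expR0 ler_expR.
by apply: le_trans (expR_ge1Dxn L x0); rewrite lerDr.
Qed.

Lemma decay_gauss_weight (R : realType) L :
  decay L (fun n => @gauss_weight R n (pi / 2)).
Proof.
exists (2 ^+ L * (L`!)%:R) => [|n n0]; first by rewrite mulr_ge0 ?exprn_ge0.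
rewrite ger0_norm ?expR_ge0 //.
have n2 : 0 <= n%:R / 2 :> R by rewrite divr_ge0.
apply: le_trans (ler_wpM2l _ (expRN_mulXn_le L n2)); last by rewrite exprn_ge0.
rewrite mulrCA -exprMn [2 * _]mulrC divfK // ler_wpM2r ?exprn_ge0 //.
rewrite ler_expR lerN2 ler_wpM2l // ler_peMl ?invr_ge0 //.
by rewrite exprn_ege1 // pihalf_ge1.
Qed.

Lemma decay_expR_sqrt (R : realType) L :
  decay L (fun n => expR (1 - Num.sqrt (n%:R / 2) * (pi / 2)) : R).
Proof.
exists (expR 1 * (2 ^+ L * ((2 * L)`!)%:R)) => [|n n0].
  by rewrite !mulr_ge0 ?expR_ge0 ?exprn_ge0.
rewrite ger0_norm ?expR_ge0 // expRD -mulrA ler_wpM2l ?expR_ge0 //.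
set s := Num.sqrt _; have s0 : 0 <= s by exact: sqrtr_ge0.
(* The exponential decays only in s, which is of size sqrt n, so L powers of n cost 2L powers of
   s. *)
have nE : n%:R ^+ L = 2 ^+ L * s ^+ (2 * L) :> R.
  by rewrite exprM -exprMn sqr_sqrtr ?divr_ge0 // mulrC divfK.
rewrite nE mulrCA ler_wpM2l ?exprn_ge0 //.
apply: le_trans (expRN_mulXn_le (2 * L) s0).
rewrite ler_wpM2r ?exprn_ge0 // ler_expR lerN2 ler_peMr //.
exact: pihalf_ge1.
Qed.

(** The substitution x -> sqrt(n/2) x brings the weight to e^(-x^2). *)
Lemma gauss_int0 (R : realType) n : (0 < n)%N ->
  gauss_int R 0 n * Num.sqrt (n%:R / 2) =
  gauss_primitive (Num.sqrt (n%:R / 2) * (pi / 2)).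
Proof.
move=> n0; set s := Num.sqrt _.
have s0 : 0 < s by rewrite sqrtr_gt0 divr_gt0 ?ltr0n.
have ds : derive1 (fun x : R => s * x) = cst s.
  apply/funext => x; rewrite derive1E; apply: derive_val.
  by apply: (is_derive_eq (is_deriveZ s (is_derive_id x 1))); rewrite scaler1.
have := @integration_by_substitution_increasing R (fun x => s * x) gauss_fun
  0 (pi / 2) (ltW (pihalf_gt0 R)).
rewrite mulr0 ds => H.
rewrite /gauss_primitive /Rintegral H.
- rewrite mulrC -integral_pihalfZ.
    congr fine; apply: eq_integral => x _ /=; congr EFin.
    rewrite muln0 expr0 mul1r [RHS]mulrC; congr (_ * _).
    transitivity (expR (- (s * (x : R)) ^+ 2)); last by [].
    rewrite /gauss_weight exprMn sqr_sqrtr ?divr_ge0 //.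
    by congr expR; ring.
  by move=> x; apply: cvgM; [exact: exprn_continuous|exact: continuous_gauss_weight].
- by move=> x y _ _ xy; rewrite ltr_pM2l.
- by move=> x _; exact: cst_continuous.
- exact: is_cvg_cst.
- exact: is_cvg_cst.
- split=> [x _||].
  + by apply: derivableM; [exact: derivable_cst|exact: derivable_id].
  + by apply: cvg_at_right_filter; exact: continuous_mull.
  + by apply: cvg_at_left_filter; exact: continuous_mull.
- exact/continuous_subspaceT/continuous_gauss_fun.
Qed.

(** Over the whole half-line the integral of x^(2i) e^(-n x^2/2) is sqrt(pi/2) m_(2i) n^(-i-1/2);
    this normalization leaves m_(2i). *)
Definition norm_gauss_int (R : realType) (i n : nat) : R :=
  Num.sqrt (2 / pi) * (n%:R ^+ i * Num.sqrt n%:R) * gauss_int R i n.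

Lemma gauss_momentS (R : realType) i :
  gauss_moment R i.+1 = (2 * i + 1)%:R * gauss_moment R i.
Proof.
rewrite /gauss_moment mulnS 2!factS factS !natrM exprS.
have -> : (2 + 2 * i)%:R = 2 * i.+1%:R :> R by rewrite -mulnS natrM.
have -> : (1 + 2 * i)%:R = (2 * i + 1)%:R :> R by rewrite addnC.
by field; rewrite expf_neq0 // nat1r !pnatr_eq0 -lt0n fact_gt0.
Qed.

(** Cutting the integral at pi/2 costs less than any power of n: for i = 0 by the tail bound, and
    then because each integration by parts multiplies the error by 2i+1 and adds a boundary term
    that also decays rapidly. *)
Lemma decay_norm_gauss_int (R : realType) i L :
  decay L (fun n => norm_gauss_int R i n - gauss_moment R i).
Proof.
elim: i L => [|i IHi] L.
  have d := decayZ (2 / Num.sqrt pi) (decay_expR_sqrt R L).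
  apply: decay_le d => n n0.
  have sp : 0 < Num.sqrt pi :> R by rewrite sqrtr_gt0 pi_gt0.
  have sn : 0 < Num.sqrt n%:R :> R by rewrite sqrtr_gt0 ltr0n.
  have s2 : 0 < Num.sqrt 2 :> R by rewrite sqrtr_gt0 ltr0n.
  set y := Num.sqrt (n%:R / 2) * (pi / 2).
  have -> : norm_gauss_int R 0 n - gauss_moment R 0 =
      - (2 / Num.sqrt pi * (Num.sqrt pi / 2 - gauss_primitive y)).
    have -> : gauss_moment R 0 = 1 by rewrite /gauss_moment muln0 expr0 mul1r divff.
    rewrite -gauss_int0 // /norm_gauss_int expr0 mul1r !sqrtrM ?ler0n // !sqrtrV ?pi_ge0 //.
    have e : Num.sqrt 2 = 2 / Num.sqrt 2 :> R.
      by rewrite -{2}(@sqr_sqrtr _ 2) // expr2 mulfK ?gt_eqF.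
    by rewrite [in LHS]e; field; rewrite !gt_eqF.
  rewrite normrN !normrM ler_wpM2l // [leRHS]ger0_norm ?expR_ge0 //.
  apply: gauss_primitive_tail; rewrite mulr_gt0 ?pihalf_gt0 //.
  by rewrite sqrtr_gt0 divr_gt0 ?ltr0n.
have d1 := decayZ (2 * i + 1)%:R (IHi L).
have d2 := decayZ (Num.sqrt (2 / pi) * (pi / 2) ^+ (2 * i + 1))
   (decayXn (decay_gauss_weight R (L + i.+1))).
(* The half-integral power n^i sqrt n is dominated by n^(i+1). *)
have d3 : decay L (fun n => - (Num.sqrt (2 / pi) * (pi / 2) ^+ (2 * i + 1) *
   (n%:R ^+ i * Num.sqrt n%:R * gauss_weight n (pi / 2))) : R).
  apply: decay_le d2 => n n0; rewrite normrN [leLHS]normrM [leRHS]normrM.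
  rewrite ler_wpM2l // [leLHS]normrM [leRHS]normrM ler_wpM2r //.
  rewrite !ger0_norm ?mulr_ge0 ?sqrtr_ge0 ?exprn_ge0 // exprSr ler_wpM2l ?exprn_ge0 //.
  have h : 1 <= Num.sqrt n%:R :> R by rewrite -[leLHS]sqrtr1 ler_wsqrtr // ler1n.
  by rewrite -[leRHS](@sqr_sqrtr _ n%:R) // expr2 ler_peMl.
apply: decay_le (decayD d1 d3) => n n0; rewrite le_eqVlt; apply/orP; left.
apply/eqP; congr `|_|; rewrite gauss_momentS /norm_gauss_int exprS.
transitivity (Num.sqrt (2 / pi) * (n%:R ^+ i * Num.sqrt n%:R) * (n%:R * gauss_int R i.+1 n)
   - (2 * i + 1)%:R * gauss_moment R i); first by ring.
by rewrite gauss_intS; ring.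
Qed.

Lemma decay0_norm_gauss_int (R : realType) i : decay 0 (@norm_gauss_int R i).
Proof.
have dm : decay 0 (fun=> gauss_moment R i).
  by exists `|gauss_moment R i| => // n _; rewrite expr0 mulr1.
by apply: decay_le (decayD (decay_norm_gauss_int R i 0) dm) => n _; rewrite subrK.
Qed.

(** * Laplace's method *)

(** The remainder vanishes at 0 and its derivative is minus the preceding remainder, so the mean
    value theorem adds one power of y. *)
Lemma expRN_taylor (R : realType) K (y : R) : 0 <= y ->
  `|expR (- y) - (exp_poly K (-1)).[y]| <= y ^+ K.
Proof.
elim: K y => [|K IHK] y y0.
  rewrite expr0 /exp_poly poly_def big_ord0 horner0 subr0 ger0_norm ?expR_ge0 //.
  by rewrite -expR0 ler_expR oppr_le0.
pose g (z : R) : R := expR (- z) - (exp_poly K.+1 (-1)).[z].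
have dp : (exp_poly K.+1 (-1 : R))^`() = - exp_poly K (-1).
  apply/polyP => i; rewrite coef_deriv coefN !coef_poly ltnS.
  case: ifP => _; last by rewrite mul0rn oppr0.
  rewrite -mulr_natr factS natrM exprS; field.
  by rewrite pnatr_eq0 -lt0n fact_gt0 nat1r pnatr_eq0.
have dg (z : R) : is_derive z 1 g (- (expR (- z) - (exp_poly K (-1)).[z])).
  have d1 : is_derive z 1 (fun z : R => expR (- z)) (expR (- z) * - 1).
    exact: (@is_derive1_comp _ expR _ _ _ _ (is_derive_expR _) (is_deriveNid z 1)).
  apply: (is_derive_eq (is_deriveB d1 (is_derive_poly _ z))).
  by rewrite dp hornerN; ring.
have [c] : exists2 c, c \in `[0, y]%R &
    g y - g 0 = - (expR (- c) - (exp_poly K (-1)).[c]) * (y - 0).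
  apply: (@MVT_segment _ g (fun c => - (expR (- c) - (exp_poly K (-1)).[c]))) => //.
  by apply: derivable_within_continuous => x _; case: (dg x).
rewrite in_itv /= => /andP[c0 cy].
have -> : g 0 = 0.
  by rewrite /g oppr0 expR0 horner_coef0 coef_poly /= expr0 divr1 subrr.
rewrite !subr0 -/(g y) => ->; rewrite normrM normrN (ger0_norm y0) exprSr.
rewrite ler_wpM2r // (le_trans (IHK c c0)) //.
by rewrite lerXn2r ?nnegrE.
Qed.

Lemma sin_ge0_pihalf (R : realType) (x : R) : 0 <= x <= pi / 2 -> 0 <= sin x.
Proof.
move=> /andP[x0 xp]; apply: sin_ge0_pi; rewrite x0 (le_trans xp) //.
by rewrite ler_pdivrMr // ler_peMr ?pi_ge0 // ler1n.
Qed.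

(** The product cos y e^(y^2/2) decreases from 1, by y cos y <= sin y. This argument takes no
    logarithm and so includes pi/2. *)
Lemma cos_le_gauss (R : realType) (x : R) : 0 <= x <= pi / 2 ->
  cos x <= expR (- (x ^+ 2 / 2)).
Proof.
move=> /andP[x0 xp].
have xcos (y : R) : 0 <= y <= pi / 2 -> y * cos y <= sin y.
  move=> /andP[y0 yp]; rewrite -subr_ge0.
  have := @le_is_derive R (fun y => sin y - y * cos y) (fun y => y * sin y) 0 y y0.
  rewrite sin0 mul0r subr0; apply=> z /andP[z0 zy].
    have d := is_deriveM (is_derive_id z 1) (is_derive_cos z).
    apply: (is_derive_eq (is_deriveB (is_derive_sin z) d)).
    by rewrite /GRing.scale /=; ring.
  by rewrite mulr_ge0 // sin_ge0_pihalf // z0 (le_trans zy).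
rewrite expRN -[leRHS]mul1r ler_pdivlMr ?expR_gt0 // -lerN2.
have := @le_is_derive R (fun y => - (cos y * expR (y ^+ 2 / 2)))
  (fun y => (sin y - y * cos y) * expR (y ^+ 2 / 2)) 0 x x0.
rewrite cos0 expr0n /= mul0r expR0 mulr1; apply=> y /andP[y0 yx].
  have d1 : is_derive y 1 (fun y : R => y ^+ 2 / 2) (2 * y ^+ 1 / 2).
    exact: (is_derive_mulr _ (is_derive_exprn 2 y)).
  have d2 := @is_derive1_comp _ expR _ _ _ _ (is_derive_expR _) d1.
  apply: (is_derive_eq (is_deriveN (is_deriveM (is_derive_cos y) d2))).
  by rewrite /GRing.scale /= expr1; field.
by rewrite mulr_ge0 ?expR_ge0 // subr_ge0 xcos // y0 (le_trans yx).
Qed.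

Lemma rho_ge0 (R : realType) (x : R) : 0 <= x <= 1 -> 0 <= rho x.
Proof.
move=> xI; have c0 := cos_gt0_01 xI; have /andP[x0 x1] := xI.
rewrite /rho subr_ge0 -lerN2 opprK -ler_expR lnK ?posrE //.
by apply: cos_le_gauss; rewrite x0 (le_trans x1) // pihalf_ge1.
Qed.

Lemma cosXn_rho (R : realType) n (x : R) : 0 <= x <= 1 ->
  cos x ^+ n = gauss_weight n x * expR (- (n%:R * rho x)).
Proof.
move=> xI; have c0 := cos_gt0_01 xI.
rewrite /gauss_weight -expRD -{1}(lnK c0) -expRM_natl; congr expR.
by rewrite /rho; ring.
Qed.

(** The Taylor polynomial of rho^k sin x sin(m x) in the variable x^2. The cut M = 2N+3 makes the
    remainder x^(2M) at most x^(2(k+N+2)) on [0, 1] for every k <= N+1. *)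
Definition laplace_poly (R : realType) (N m k : nat) : {poly R} :=
  let M := (2 * N + 3)%N in
  'X * ('X * gen_trunc (fun m => alpha R m.+1) M) ^+ k
  * (sin_poly M 1 * sin_poly M m%:R).

Lemma jet_laplace_poly (R : realType) N m k :
  jet (2 * (2 * N + 3)) (fun x : R => rho x ^+ k * (sin x * sin (m%:R * x)))
    (laplace_poly R N m k \Po 'X^2).
Proof.
set M := (2 * N + 3)%N.
have jr : jet (2 * M) (@rho R) (('X * gen_trunc (fun m => alpha R m.+1) M) \Po 'X^2).
  by apply: jet_le (jet_rho R M); rewrite leq_addr.
have [_ js1] := jet_sin_cos (1 : R) M; have [_ jsm] := jet_sin_cos (m%:R : R) M.
have := jetM (jetX k jr) (jetM (jet_le (leq_addr 1 _) js1) (jet_le (leq_addr 1 _) jsm)).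
rewrite /laplace_poly -/M !comp_polyM comp_polyX !rmorphXn /= comp_polyM comp_polyX.
set q := _ ^+ k; set s := sin_poly _ _ \Po _; set t := sin_poly _ _ \Po _.
have -> : q * ('X * s * ('X * t)) = 'X ^+ 2 * q * (s * t) by ring.
by apply: eq_jet => x _; rewrite mul1r.
Qed.

Lemma jet_uniform (R : realType) N (f : nat -> R -> R) p K :
  (forall k, jet N (f k) (p k)) ->
  exists2 C : R, 0 <= C & forall k x, (k < K)%N -> 0 <= x <= 1 ->
    `|f k x - (p k).[x]| <= C * x ^+ N.
Proof.
move=> jf; elim: K => [|K [C C0 fC]]; first by exists 0.
have [D D0 fD] := jf K; exists (C + D) => [|k x]; first exact: addr_ge0.
rewrite ltnS leq_eqVlt => /predU1P[->|kK] /[dup] xI /andP[x0 x1].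
  by apply: le_trans (fD x xI) _; rewrite ler_wpM2r ?exprn_ge0 // lerDr.
by apply: le_trans (fC k x kK xI) _; rewrite ler_wpM2r ?exprn_ge0 // lerDl.
Qed.

Lemma poly_bound_uniform (R : realType) (c : R) (p : nat -> {poly R}) K : 0 < c ->
  exists2 C : R, 0 <= C & forall k x, (k < K)%N -> 0 <= x <= c ->
    `|(p k).[x]| <= C.
Proof.
move=> c0.
(* After rescaling to [0, 1], boundedness is an expansion of order 0 with zero polynomial. *)
have [|C C0 pC] := @jet_uniform _ 0 (fun k x => (p k).[c * x]) (fun=> 0) K.
  move=> k; have [D D0 pD] := poly_bound01 (p k \Po (c *: 'X)).
  exists D => // x xI; rewrite horner0 subr0 expr0 mulr1.
  by have := pD x xI; rewrite horner_comp hornerZ hornerX.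
exists C => // k x kK /andP[x0 xc].
have := pC k (x / c) kK; rewrite horner0 subr0 expr0 mulr1 mulrCA divff ?gt_eqF // mulr1.
by apply; rewrite divr_ge0 ?(ltW c0) // ler_pdivrMr // mul1r.
Qed.

Definition laplace_sum (R : realType) (N m n : nat) (x : R) : R :=
  \sum_(k < N.+2) (- n%:R) ^+ k / (k`!)%:R * (laplace_poly R N m k).[x ^+ 2].

(** All its terms have the same size n^(-N-2) at x^2 = 1/n. Those with k < N+2 absorb the Taylor
    remainders at 0, the last one that of the exponential. *)
Definition laplace_error (R : realType) (N n : nat) (x : R) : R :=
  \sum_(k < N.+3) n%:R ^+ k * x ^+ (2 * (k + N + 2)).

Lemma ler_sum_norm (R : realType) K (u v : nat -> R) :
  (forall k, (k < K)%N -> `|u k| <= v k) ->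
  `|\sum_(k < K) u k| <= \sum_(k < K) v k.
Proof.
move=> uv; apply: le_trans (ler_norm_sum _ _ _) _.
by apply: ler_sum => k _; exact: uv.
Qed.

Lemma norm_invfact_le (R : realType) n k (z : R) :
  `|(- n%:R) ^+ k / (k`!)%:R * z| <= n%:R ^+ k * `|z|.
Proof.
rewrite !normrM normrX normrN normr_nat ler_wpM2r // normfV normr_nat.
by rewrite ler_piMr ?exprn_ge0 // invf_le1 ?ler1n ?ltr0n fact_gt0.
Qed.

Lemma laplace_near (R : realType) N m : exists2 C : R, 0 <= C &
  forall n x, 0 <= x <= 1 ->
    `|cos x ^+ n * (sin x * sin (m%:R * x)) - gauss_weight n x * laplace_sum N m n x|
      <= C * (gauss_weight n x * laplace_error N n x).
Proof.
have [D D0 rD] := jet_rho R 0.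
have [E E0 lE] := jet_uniform N.+2 (jet_laplace_poly R N m).
exists (D ^+ N.+2 + E) => [|n x xI]; first by rewrite addr_ge0 ?exprn_ge0.
have /andP[x0 x1] := xI; have r0 := rho_ge0 xI.
have {}rD : rho x <= D * x ^+ 4.
  have := rD x xI; rewrite /gen_trunc big_geq // mulr0 comp_poly0 horner0 subr0.
  by rewrite ger0_norm.
set F := sin x * sin _.
have F1 : `|F| <= 1 by rewrite normrM mulr_ile1 ?sin_max.
have nr0 : 0 <= n%:R * rho x by rewrite mulr_ge0.
rewrite (cosXn_rho n xI) -mulrA -mulrBr normrM [`|gauss_weight _ _|]ger0_norm ?expR_ge0 //.
rewrite [leRHS]mulrCA ler_wpM2l ?expR_ge0 //.
set e := expR _.
(* The exponential is first replaced by its Taylor polynomial in n rho, then each rho^k sin x sin(m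
   x) by its own. *)
have -> : e * F - laplace_sum N m n x =
   (e - (exp_poly N.+2 (-1)).[n%:R * rho x]) * F +
   \sum_(k < N.+2) (- n%:R) ^+ k / (k`!)%:R * (rho x ^+ k * F
     - (laplace_poly R N m k \Po 'X^2).[x]).
  rewrite mulrBl -addrA; congr (_ + _).
  rewrite (eq_bigr (fun k : 'I_N.+2 => (- n%:R) ^+ k / (k`!)%:R * rho x ^+ k * F -
    (- n%:R) ^+ k / (k`!)%:R * (laplace_poly R N m k).[x ^+ 2])); last first.
    by move=> k _; rewrite horner_comp hornerXn; ring.
  rewrite big_split /= sumrN -/(laplace_sum N m n x) addrA horner_poly mulr_suml.
  rewrite (eq_bigr (fun k : 'I_N.+2 => (- n%:R) ^+ k / (k`!)%:R * rho x ^+ k * F)).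
    by rewrite addNr add0r.
  by move=> k _; rewrite exprMn -[- n%:R]mulN1r exprMn; ring.
rewrite (le_trans (ler_normD _ _)) // /laplace_error [X in _ <= _ * X]big_ord_recr /=.
rewrite [leRHS]mulrDr [leLHS]addrC; apply: lerD.
  apply: le_trans (_ : \sum_(k < N.+2) n%:R ^+ k * (E * x ^+ (2 * (2 * N + 3))) <= _).
    apply: (@ler_sum_norm _ N.+2
      (fun k => (- n%:R) ^+ k / (k`!)%:R * (rho x ^+ k * F - (laplace_poly R N m k \Po 'X^2).[x]))
      (fun k => n%:R ^+ k * (E * x ^+ (2 * (2 * N + 3))))) => k kN.
    apply: le_trans (norm_invfact_le _ _ _) _.
    by rewrite ler_wpM2l ?exprn_ge0 // lE.
  rewrite -[leLHS]add0r [leRHS]mulrDl; apply: lerD.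
    by rewrite mulr_ge0 ?exprn_ge0 // sumr_ge0 // => k _; rewrite mulr_ge0 ?exprn_ge0.
  rewrite mulr_sumr; apply: ler_sum => -[k /= kN] _.
  rewrite mulrCA ler_wpM2l // ler_wpM2l ?exprn_ge0 // ler_wiXn2l //.
  by lia.
rewrite [leRHS]mulrDl -[leLHS]addr0; apply: lerD; last first.
  by rewrite mulr_ge0 // mulr_ge0 ?exprn_ge0.
rewrite normrM -[leRHS]mulr1 ler_pM //.
apply: le_trans (expRN_taylor _ nr0) _; rewrite exprMn [leRHS]mulrCA ler_wpM2l ?exprn_ge0 //.
have -> : x ^+ (2 * (N.+2 + N + 2)) = (x ^+ 4) ^+ N.+2.
  by rewrite -exprM; congr (_ ^+ _); lia.
by rewrite -exprMn lerXn2r ?nnegrE ?mulr_ge0 ?exprn_ge0.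
Qed.

(** For x >= 1 [laplace_error] is at least the sum of the n^k, hence at least 1, so the two
    quantities are bounded separately without any cancellation. *)
Lemma laplace_far (R : realType) N m : exists2 C : R, 0 <= C &
  forall n x, 1 <= x <= pi / 2 ->
    `|cos x ^+ n * (sin x * sin (m%:R * x)) - gauss_weight n x * laplace_sum N m n x|
      <= C * (gauss_weight n x * laplace_error N n x).
Proof.
have [B B0 pB] := poly_bound_uniform (fun k => laplace_poly R N m k \Po 'X^2) N.+2 (pihalf_gt0 R).
exists (1 + B) => [|n x /andP[x1 xp]]; first by rewrite addr_ge0.
have x0 : 0 <= x by rewrite (le_trans ler01).
have xI : 0 <= x <= pi / 2 by rewrite x0.
set F := sin x * sin _.
have F1 : `|F| <= 1 by rewrite normrM mulr_ile1 ?sin_max.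
have c0 : 0 <= cos x.
  by apply: cos_ge0_pihalf; rewrite xp andbT (le_trans _ x0) // oppr_le0 ltW ?pihalf_gt0.
have cn : cos x ^+ n <= gauss_weight n x.
  rewrite /gauss_weight -mulrN expRM_natl lerXn2r ?nnegrE ?expR_ge0 //.
  exact: cos_le_gauss.
have low : \sum_(k < N.+2) n%:R ^+ k <= laplace_error N n x.
  rewrite /laplace_error [leRHS]big_ord_recr /= -[leLHS]addr0.
  apply: lerD; last by rewrite mulr_ge0 ?exprn_ge0.
  apply: ler_sum => k _.
  by rewrite ler_peMr ?exprn_ge0 // exprn_ege1.
have one : 1 <= laplace_error N n x.
  apply: le_trans low; rewrite big_ord_recl expr0 lerDl; apply: sumr_ge0 => k _.
  by rewrite exprn_ge0.
rewrite (le_trans (ler_normB _ _)) // mulrDl mul1r lerD //.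
  rewrite normrM ger0_norm ?exprn_ge0 // ler_pM ?exprn_ge0 //.
  exact: le_trans one.
rewrite normrM ger0_norm ?expR_ge0 // [leRHS]mulrCA ler_wpM2l ?expR_ge0 //.
apply: le_trans (ler_wpM2l B0 low); rewrite mulr_sumr.
apply: (@ler_sum_norm _ N.+2
  (fun k => (- n%:R) ^+ k / (k`!)%:R * (laplace_poly R N m k).[x ^+ 2])
  (fun k => B * n%:R ^+ k)) => k kN.
apply: le_trans (norm_invfact_le _ _ _) _; rewrite mulrC ler_wpM2r ?exprn_ge0 //.
by have := pB k x kN xI; rewrite horner_comp hornerXn.
Qed.

Lemma laplace_bound (R : realType) N m : exists2 C : R, 0 <= C &
  forall n x, 0 <= x <= pi / 2 ->
    `|cos x ^+ n * (sin x * sin (m%:R * x)) - gauss_weight n x * laplace_sum N m n x|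
      <= C * (gauss_weight n x * laplace_error N n x).
Proof.
have [C C0 near] := laplace_near R N m; have [D D0 far] := laplace_far R N m.
exists (C + D) => [|n x /andP[x0 xp]]; first exact: addr_ge0.
have e0 : 0 <= gauss_weight n x * laplace_error N n x.
  rewrite mulr_ge0 ?expR_ge0 // sumr_ge0 // => k _.
  by rewrite mulr_ge0 ?exprn_ge0.
rewrite mulrDl; have [x1|/ltW x1] := leP x 1.
  by apply: le_trans (near n x _) _; rewrite ?x0 // lerDl mulr_ge0.
by apply: le_trans (far n x _) _; rewrite ?x1 // lerDr mulr_ge0.
Qed.

Lemma continuous_weightXn (R : realType) n i :
  continuous (fun x : R => x ^+ (2 * i) * gauss_weight n x).
Proof.
by move=> x; apply: cvgM; [exact: exprn_continuous|exact: continuous_gauss_weight].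
Qed.

Lemma continuous_weight_poly (R : realType) n (p : {poly R}) :
  continuous (fun x : R => gauss_weight n x * p.[x ^+ 2]).
Proof.
move=> x; apply: cvgM; first exact: continuous_gauss_weight.
suff : continuous (fun x : R => p.[x ^+ 2]) by exact.
under eq_fun do rewrite -[_ ^+ 2]hornerXn -horner_comp.
exact: continuous_horner.
Qed.

Lemma integral_weight_poly (R : realType) n (p : {poly R}) :
  integral_pihalf (fun x : R => gauss_weight n x * p.[x ^+ 2]) =
  \sum_(i < size p) p`_i * gauss_int R i n.
Proof.
transitivity (\sum_(i < size p) integral_pihalf
    (fun x : R => p`_i * (x ^+ (2 * i) * gauss_weight n x))).
  rewrite -(integral_pihalf_sum (size p)
    (f := fun i x => p`_i * (x ^+ (2 * i) * gauss_weight n x))).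
    apply: eq_integral_pihalf => x; rewrite horner_coef mulr_sumr.
    by apply: eq_bigr => i _; rewrite exprM; ring.
  by move=> i x; apply: cvgM; [exact: cvg_cst|exact: continuous_weightXn].
apply: eq_bigr => i _; rewrite integral_pihalfZ //; exact: continuous_weightXn.
Qed.

Lemma norm_integral_pihalfB (R : realType) (f g h : R -> R) :
  continuous f -> continuous g -> continuous h ->
  (forall x, 0 <= x <= pi / 2 -> `|f x - g x| <= h x) ->
  `|integral_pihalf f - integral_pihalf g| <= integral_pihalf h.
Proof.
move=> cf cg ch fgh; rewrite ler_norml -[leLHS]add0r lerBlDr.
apply/andP; split.
  rewrite addrAC -lerBlDr opprK -integral_pihalfD // add0r.
  apply: le_integral_pihalf => // [x|x xI]; first by apply: cvgD; [exact: cf|exact: ch].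
  by have := fgh x xI; rewrite ler_norml; lra.
rewrite lerBlDr -integral_pihalfD //.
apply: le_integral_pihalf => // [x|x xI]; first by apply: cvgD; [exact: ch|exact: cg].
by have := fgh x xI; rewrite ler_norml; lra.
Qed.

Definition laplace_main (R : realType) (N m n : nat) : R :=
  \sum_(k < N.+2) (- n%:R) ^+ k / (k`!)%:R *
    \sum_(i < size (laplace_poly R N m k)) (laplace_poly R N m k)`_i * gauss_int R i n.

Lemma integral_laplace_sum (R : realType) N m n :
  integral_pihalf (fun x : R => gauss_weight n x * laplace_sum N m n x) =
  laplace_main R N m n.
Proof.
transitivity (\sum_(k < N.+2) integral_pihalf (fun x : R =>
   (- n%:R) ^+ k / (k`!)%:R * (gauss_weight n x * (laplace_poly R N m k).[x ^+ 2]))).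
  rewrite -(integral_pihalf_sum N.+2 (f := fun k x =>
    (- n%:R) ^+ k / (k`!)%:R * (gauss_weight n x * (laplace_poly R N m k).[x ^+ 2]))).
    apply: eq_integral_pihalf => x; rewrite mulr_sumr.
    by apply: eq_bigr => i _; rewrite mulrCA.
  by move=> i x; apply: cvgM; [exact: cvg_cst|exact: continuous_weight_poly].
apply: eq_bigr => i _; rewrite integral_pihalfZ ?integral_weight_poly //.
exact: continuous_weight_poly.
Qed.

Lemma integral_laplace_error (R : realType) N n :
  integral_pihalf (fun x : R => gauss_weight n x * laplace_error N n x) =
  \sum_(k < N.+3) n%:R ^+ k * gauss_int R (k + N + 2) n.
Proof.
transitivity (\sum_(k < N.+3) integral_pihalf (fun x : R =>
   n%:R ^+ k * (x ^+ (2 * (k + N + 2)) * gauss_weight n x))).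
  rewrite -(integral_pihalf_sum N.+3 (f := fun k x =>
    n%:R ^+ k * (x ^+ (2 * (k + N + 2)) * gauss_weight n x))).
    apply: eq_integral_pihalf => x; rewrite mulr_sumr.
    by apply: eq_bigr => i _; ring.
  by move=> i x; apply: cvgM; [exact: cvg_cst|exact: continuous_weightXn].
apply: eq_bigr => i _; rewrite integral_pihalfZ //.
exact: continuous_weightXn.
Qed.

(* [2 ^+ n.+2 / pi] divided by the prefactor of the expansion. *)
Definition scale_factor (R : realType) (n : nat) : R :=
  Num.sqrt (2 / pi) * (n%:R * Num.sqrt n%:R).

Lemma scale_factor_gauss_int (R : realType) i n : (0 < n)%N ->
  scale_factor R n * gauss_int R i n = n%:R * norm_gauss_int R i n / n%:R ^+ i.
Proof.
move=> n0; rewrite /scale_factor /norm_gauss_int; field.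
by rewrite expf_neq0 // pnatr_eq0 -lt0n.
Qed.

Lemma decay_weaken (R : realType) L M (u : nat -> R) : (L <= M)%N ->
  decay M u -> decay L u.
Proof.
move=> leLM [C C0 uC]; exists C => // n n0; apply: le_trans (uC n n0).
by rewrite ler_wpM2l // ler_weXn2l // ler1n.
Qed.

Lemma eq_decay (R : realType) L (u v : nat -> R) :
  (forall n, (0 < n)%N -> u n = v n) -> decay L v -> decay L u.
Proof. by move=> uv; apply: decay_le => n n0; rewrite uv. Qed.

Lemma decay_laplace_main (R : realType) N m :
  decay N.+1 (fun n => scale_factor R n *
    (cos_sin_integral R m n - laplace_main R N m n)).
Proof.
have [C C0 bd] := laplace_bound R N m.
have d : decay N.+1 (fun n => C * \sum_(k < N.+3)
    norm_gauss_int R (k + N + 2) n / n%:R ^+ N.+1).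
  apply: decayZ; apply: (decay_sum (u := fun k n =>
    norm_gauss_int R (k + N + 2) n / n%:R ^+ N.+1)) => k _.
  exact: (decayVXn N.+1 (decay0_norm_gauss_int R (k + N + 2))).
apply: decay_le d => n n0.
have sf0 : 0 <= scale_factor R n by rewrite !mulr_ge0 ?sqrtr_ge0.
have cle : continuous (@laplace_error R N n).
  suff : continuous (fun x : R => \sum_(k < N.+3) n%:R ^+ k * x ^+ (2 * (k + N + 2))) by [].
  apply: (@continuous_sum _ N.+3 (fun k x => n%:R ^+ k * x ^+ (2 * (k + N + 2)))).
  by move=> k y; apply: cvgM; [exact: cvg_cst|exact: exprn_continuous].
have cerr : continuous (fun x : R => gauss_weight n x * laplace_error N n x).
  by move=> x; apply: cvgM; [exact: continuous_gauss_weight|exact: cle].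
have csum : continuous (fun x : R => gauss_weight n x * laplace_sum N m n x).
  have -> : laplace_sum N m n = fun x : R => (\sum_(k < N.+2)
      ((- n%:R) ^+ k / (k`!)%:R) *: laplace_poly R N m k).[x ^+ 2].
    apply/funext => x; rewrite horner_sum; apply: eq_bigr => k _.
    by rewrite hornerZ.
  exact: continuous_weight_poly.
have := norm_integral_pihalfB (@continuous_cos_sin R m%:R n) csum _ (bd n).
rewrite integral_laplace_sum integral_pihalfZ // integral_laplace_error => H.
rewrite normrM ger0_norm //.
apply: le_trans (ler_wpM2l sf0 (H _)) _.
  by move=> x; apply: cvgM; [exact: cvg_cst|exact: cerr].
rewrite mulrCA normrM ger0_norm // ler_wpM2l //.
apply: le_trans (ler_norm _); rewrite mulr_sumr le_eqVlt; apply/orP; left.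
apply/eqP; apply: eq_bigr => k _.
rewrite mulrCA scale_factor_gauss_int // -addnA exprD addn2 [n%:R ^+ N.+2]exprS.
have nz : n%:R != 0 :> R by rewrite pnatr_eq0 -lt0n.
by field; rewrite nz !expf_neq0.
Qed.

(** After scaling, the term of index i = k+1+j has order n^(-j). For j <= N the normalized integral
    is replaced by its limit, and the remaining terms are O(n^(-N-1)). *)
Lemma decay_poly_moment (R : realType) (p : {poly R}) k N :
  (forall i, (i <= k)%N -> p`_i = 0) ->
  decay N.+1 (fun n => n%:R ^+ k * (scale_factor R n *
      \sum_(i < size p) p`_i * gauss_int R i n)
    - \sum_(j < N.+1) p`_(k.+1 + j) * gauss_moment R (k.+1 + j) / n%:R ^+ j).
Proof.
move=> p0.
pose u j n := p`_(k.+1 + j) * (norm_gauss_int R (k.+1 + j) n / n%:R ^+ j).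
have d1 : decay N.+1 (fun n => \sum_(j < N.+1) p`_(k.+1 + j) *
   ((norm_gauss_int R (k.+1 + j) n - gauss_moment R (k.+1 + j)) / n%:R ^+ j)).
  apply: (decay_sum (u := fun j n => p`_(k.+1 + j) *
   ((norm_gauss_int R (k.+1 + j) n - gauss_moment R (k.+1 + j)) / n%:R ^+ j))) => j _.
  apply: decayZ; apply: decay_weaken (leq_addr j _) _.
  exact/decayVXn/decay_norm_gauss_int.
have d2 : decay N.+1 (fun n => \sum_(r < size p) u (N.+1 + r)%N n).
  apply: (decay_sum (u := fun r => u (N.+1 + r)%N)) => r _; apply: decayZ.
  apply: decay_weaken (leq_addr r _) _.
  exact: (decayVXn (N.+1 + r) (decay0_norm_gauss_int R (k.+1 + (N.+1 + r)))).
apply: eq_decay (decayD d1 d2) => n n0.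
have nz : n%:R != 0 :> R by rewrite pnatr_eq0 -lt0n.
pose v i := p`_i * (n%:R ^+ k.+1 * norm_gauss_int R i n / n%:R ^+ i).
have -> : n%:R ^+ k * (scale_factor R n * \sum_(i < size p) p`_i * gauss_int R i n) =
    \sum_(i < size p) v i.
  rewrite !mulr_sumr; apply: eq_bigr => i _.
  rewrite [scale_factor R n * _]mulrCA scale_factor_gauss_int // /v exprS.
  by field; rewrite expf_neq0.
(* Padding with zero coefficients lets the sum be split at k+1 and k+1+N+1 whatever the size of
   p. *)
have -> : \sum_(i < size p) v i = \sum_(i < k.+1 + (N.+1 + size p)) v i.
  have le : (size p <= k.+1 + (N.+1 + size p))%N by lia.
  rewrite (big_ord_widen _ v le) big_mkcond; apply: eq_bigr => i _.
  by case: ltnP => // lei; rewrite /v nth_default // mul0r.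
rewrite big_split_ord /= big1 ?add0r => [|i _]; last first.
  by rewrite /v p0 ?mul0r // -ltnS.
have vE j : v (k.+1 + j)%N = u j n.
  by rewrite /v /u exprD; field; rewrite !expf_neq0.
rewrite big_split_ord /= addrAC; congr (_ + _).
  rewrite -sumrB; apply: eq_bigr => j _; rewrite vE /u; ring.
by apply: eq_bigr => j _; rewrite vE.
Qed.

(** The terms of order n^(-j): the factor n^k shifts the degree k+1+j of the k-th polynomial to the
    j-th power of 1/n. *)
Definition expansion_coef (R : realType) (N m j : nat) : R :=
  \sum_(k < N.+2) (-1) ^+ k / (k`!)%:R *
    ((laplace_poly R N m k)`_(k.+1 + j) * gauss_moment R (k.+1 + j)).

Lemma laplace_polyE (R : realType) N m k : laplace_poly R N m k =
  'X^(k.+1) * (gen_trunc (fun m => alpha R m.+1) (2 * N + 3) ^+ k *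
    (sin_poly (2 * N + 3) 1 * sin_poly (2 * N + 3) m%:R)).
Proof. by rewrite /laplace_poly exprMn exprS !mulrA. Qed.

Lemma decay_expansion (R : realType) N m :
  decay N.+1 (fun n => scale_factor R n * cos_sin_integral R m n
    - \sum_(j < N.+1) expansion_coef R N m j / n%:R ^+ j).
Proof.
pose P := laplace_poly R N m.
have P0 k i : (i <= k)%N -> (P k)`_i = 0.
  by move=> leik; rewrite /P laplace_polyE coefXnM ltnS leik.
pose w k n := (-1) ^+ k / (k`!)%:R * (n%:R ^+ k * (scale_factor R n *
      \sum_(i < size (P k)) (P k)`_i * gauss_int R i n)
    - \sum_(j < N.+1) (P k)`_(k.+1 + j) * gauss_moment R (k.+1 + j) / n%:R ^+ j).
have d : decay N.+1 (fun n => \sum_(k < N.+2) w k n).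
  apply: decay_sum => k _; apply: decayZ; apply: decay_poly_moment; exact: P0.
apply: eq_decay (decayD (decay_laplace_main R N m) d) => n n0.
rewrite mulrBr -addrA; congr (_ + _).
rewrite /w (eq_bigr (fun k : 'I_N.+2 => scale_factor R n * ((- n%:R) ^+ k / (k`!)%:R *
   \sum_(i < size (P k)) (P k)`_i * gauss_int R i n)
   - (-1) ^+ k / (k`!)%:R * \sum_(j < N.+1) (P k)`_(k.+1 + j)
     * gauss_moment R (k.+1 + j) / n%:R ^+ j)).
  rewrite big_split /= -mulr_sumr -/(laplace_main R N m n) addKr sumrN; congr (- _).
  rewrite (eq_bigr (fun k : 'I_N.+2 => \sum_(j < N.+1) (-1) ^+ k / (k`!)%:R *
    ((P k)`_(k.+1 + j) * gauss_moment R (k.+1 + j)) / n%:R ^+ j)).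
    by rewrite exchange_big /=; apply: eq_bigr => j _; rewrite -mulr_suml.
  by move=> k _; rewrite mulr_sumr; apply: eq_bigr => j _; rewrite !mulrA.
by move=> k _; rewrite mulrBr -[- n%:R]mulN1r exprMn; congr (_ - _); ring.
Qed.

(** * The coefficients of the expansion *)

Lemma coef_gen_truncX_lt (R : realType) (x : nat -> R) N k s : (s < k)%N ->
  (gen_trunc x N ^+ k)`_s = 0.
Proof.
have -> : gen_trunc x N = 'X * drop_poly 1 (gen_trunc x N).
  apply/polyP => -[|i]; rewrite coefXM /= ?coef_gen_trunc //.
  by rewrite coef_drop_poly addn1 coef_gen_trunc.
by move=> sk; rewrite exprMn coefXnM sk.
Qed.

Lemma bell_coef (R : realType) (x : nat -> R) N s k : (s <= N)%N ->
  bell s k x = (gen_trunc x N ^+ k)`_s.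
Proof.
move=> sN; rewrite /bell coef_exp_gen_trunc ?leq_addl // mulrA divff ?mul1r; last first.
  by rewrite pnatr_eq0 -lt0n fact_gt0.
by rewrite (coef_gen_truncX _ _ (leqnn s)) ?leq_addr // -(coef_gen_truncX _ _ (leqnn s) sN).
Qed.

(** With y = x^2, C_(k,p) is up to sign and k! the coefficient of y^p in (rho / y)^k (sin x / x). *)
Lemma C_alpha_coef (R : realType) M k p : (p < M)%N ->
  (gen_trunc (fun m => alpha R m.+1) M ^+ k * sin_poly M 1)`_p =
  (-1) ^+ p * (k`!)%:R * C_alpha R k p.
Proof.
move=> pM; set g := gen_trunc _ M.
have k0 : (k`!)%:R != 0 :> R by rewrite pnatr_eq0 -lt0n fact_gt0.
rewrite /C_alpha -mulrA mulVKf // big_geq_mkord big_mkcond mulr_sumr coefM.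
apply: eq_bigr => -[j /= jp] _; case: leqP => [kj|jk]; last first.
  by rewrite coef_gen_truncX_lt // mul0r mulr0.
rewrite /bell_alpha (@bell_coef _ _ M) ?(leq_trans _ (ltnW pM)) //.
rewrite coef_poly (leq_ltn_trans (leq_subr _ _) pM) expr1n mulr1.
have -> : (-1) ^+ p = (-1) ^+ j * (-1) ^+ (p - j) :> R by rewrite -exprD subnKC.
have jj : (-1) ^+ j * (-1) ^+ j = 1 :> R by rewrite -exprMn mulrNN mulr1 expr1n.
by rewrite mulnBr -[LHS]mul1r -{1}jj; ring.
Qed.

Lemma C_alpha_gt (R : realType) k p : (p < k)%N -> C_alpha R k p = 0.
Proof. by move=> pk; rewrite /C_alpha big_geq // mulr0. Qed.

Lemma expansion_coefE (R : realType) N lambda j : (j < N.+1)%N ->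
  expansion_coef R N lambda.+1 j = (-1) ^+ j * h_coef R j lambda.
Proof.
move=> jN; rewrite /expansion_coef.
pose M := (2 * N + 3)%N; pose m : R := lambda.+1%:R.
pose t k p : R := (-1) ^+ k / ((2 * (j - p) + 1)`!)%:R * C_alpha R k p
     * gauss_moment R (k + j + 1) * m ^+ (2 * (j - p) + 1).
transitivity (\sum_(k < N.+2) \sum_(p < j.+1) (-1) ^+ j * t k p).
  apply: eq_bigr => k _.
  rewrite laplace_polyE -/M coefXnM ltnNge leq_addr /=.
  rewrite addKn mulrA coefM mulr_suml mulr_sumr; apply: eq_bigr => -[p /= pj] _.
  rewrite C_alpha_coef; last by lia.
  rewrite coef_poly (_ : (j - p < M)%N); last by lia.
  rewrite /t -/m.
  have -> : (-1) ^+ j = (-1) ^+ p * (-1) ^+ (j - p) :> R by rewrite -exprD subnKC.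
  have -> : (k.+1 + j = k + j + 1)%N by lia.
  by field; rewrite !pnatr_eq0 -!lt0n !fact_gt0.
rewrite exchange_big /= /h_coef big_mkord mulr_sumr; apply: eq_bigr => -[p /= pj] _.
rewrite big_mkord -mulr_sumr; congr (_ * _).
(* The sum over k runs to N+1 on one side and to p on the other; they agree since [C_alpha] vanishes
   for k > p. *)
have le : (p.+1 <= N.+2)%N by lia.
rewrite (big_ord_widen _ (fun k => t k p) le) [RHS]big_mkcond /=.
by apply: eq_bigr => k _; case: ltnP => // pk; rewrite /t C_alpha_gt // mulr0 !mul0r.
Qed.

Lemma powR_three_half (R : realType) (x : R) : 0 <= x ->
  x `^ (3 / 2) = x * Num.sqrt x.
Proof.
rewrite le_eqVlt => /predU1P[<-|x0].
  by rewrite mul0r powR0 // mulf_neq0 ?invr_neq0.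
have -> : 3 / 2 = 1 + 2^-1 :> R by field.
by rewrite powRD ?gt_eqF // powRr1 ?ltW // powR12_sqrt // ltW.
Qed.

Theorem theorem5 (R : realType) (lambda : nat) :
  (forall n : nat, n = lambda %[mod 2] ->
     mult R lambda n =
       lambda.+1%:R / ((n + lambda + 2)%:R / 2) * 'C(n, (n + lambda)./2)%:R
     /\ mult R lambda n = #|nonneg_paths lambda n|%:R)
  /\ asymptotic_expansion (within [set n : nat | n = lambda %[mod 2]] \oo)
       (fun n => mult R lambda n)
       (fun n => 2 * Num.sqrt 2 * (2 ^+ n / Num.sqrt pi) * (1 / n%:R `^ (3 / 2)))
       (fun j => (-1) ^+ j * h_coef R j lambda).
Proof.
split=> [n nl|N].
  by rewrite {1}mult_ballot // card_nonneg_paths -mult_walk_count.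
pose g (n : nat) : R :=
  2 * Num.sqrt 2 * (2 ^+ n / Num.sqrt pi) * (1 / n%:R `^ (3 / 2)).
have [C C0 dC] := decay_expansion R N lambda.+1.
apply/eqoP => e e0; rewrite /prop_near1 /nbhs /= /within /=.
near=> n => nl; rewrite -/(g n).
have n0 : (0 < n)%N by near: n; exact: nbhs_infty_gt.
have n0R : 0 < n%:R :> R by rewrite ltr0n.
(* The remainder is at most C / n^(N+1), one order better than the scale n^(-N), so this threshold
   yields the factor e. *)
have Cn : C / e <= n%:R by near: n; exact: nbhs_infty_ger.
have sn : 0 < Num.sqrt n%:R :> R by rewrite sqrtr_gt0.
have sp : 0 < Num.sqrt pi :> R by rewrite sqrtr_gt0 pi_gt0.
have s2 : 0 < Num.sqrt 2 :> R by rewrite sqrtr_gt0.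
have multE : mult R lambda n = g n * (scale_factor R n * cos_sin_integral R lambda.+1 n).
  rewrite cos_sin_integral_walk_count // -mult_walk_count //.
  rewrite /g powR_three_half // /scale_factor !sqrtrM ?sqrtrV ?pi_ge0 //.
  rewrite [2 ^+ n.+2]exprS [2 ^+ n.+1]exprS.
  have pp : Num.sqrt pi ^+ 2 = pi :> R by rewrite sqr_sqrtr ?pi_ge0.
  have p2 : Num.sqrt 2 ^+ 2 = 2 :> R by rewrite sqr_sqrtr.
  have tn : 2 ^+ n != 0 :> R by rewrite expf_neq0.
  (* A factor equal to 1 exposes the squares of the two square roots, so that what remains is a
     rational identity. *)
  transitivity (Num.sqrt 2 ^+ 2 * pi / (Num.sqrt pi ^+ 2 * 2) * mult R lambda n).
    by rewrite p2 pp [2 * pi]mulrC divff ?mul1r // mulf_neq0 // gt_eqF ?pi_gt0.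
  by field; rewrite tn !gt_eqF.
rewrite multE -mulrBr.
have -> : \sum_(j < N.+1) (-1) ^+ j * h_coef R j lambda / n%:R ^+ j =
    \sum_(j < N.+1) expansion_coef R N lambda.+1 j / n%:R ^+ j.
  by apply: eq_bigr => j _; rewrite expansion_coefE.
rewrite [leLHS]normrM [`|g n / _|]normrM normfV [leRHS]mulrCA ler_wpM2l //.
rewrite [`|_ ^+ N|]ger0_norm ?exprn_ge0 // ler_pdivlMr ?exprn_gt0 //.
move: (dC n n0); set u := `|_ - _| => du; apply: (le_trans (y := C / n%:R)).
  by rewrite ler_pdivlMr // -mulrA -exprSr.
by rewrite ler_pdivrMr // mulrC -ler_pdivrMr.
Unshelve. all: by end_near. Qed.
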